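(* Let $X_1, X_2$ be compact metric spaces and let $\mathcal{A}_1,\mathcal{A}_2$ be unital factor $C^{*}$-algebras. A map $U: (\operatorname{Lip}(X_1,\mathcal{A}_1), \|\cdot\|_{L}) \to (\operatorname{Lip}(X_2,\mathcal{A}_2), \|\cdot\|_{L})$ is a surjective complex linear isometry such that $U(1)=1$ if and only if there exist a unital surjective complex linear isometry $\psi:\mathcal{A}_1 \to \mathcal{A}_2$ and a surjective isometry $\varphi:X_2 \to X_1$ such that \[ (UF)(y)=\psi(F(\varphi(y))) \quad \text{for all } F \in \operatorname{Lip}(X_1,\mathcal{A}_1),\ y \in X_2. \]
   Context: Metric spaces are nonempty. For a compact metric space $(X,d)$ and a complex Banach space $(E,\|\cdot\|_E)$, $\operatorname{Lip}(X,E)$ is the space of all maps $F:X\to E$ with $L(F):=\sup_{x\neq y\in X}\frac{\|F(x)-F(y)\|_E}{d(x,y)}<\infty$ (with $L(F)=0$ if $X$ is a single point). It is a Banach space with the sum norm $\|F\|_L=\sup_{x\in X}\|F(x)\|_E+L(F)$. For a unital $C^*$-algebra $\mathcal{A}$, the symbol $1$ also denotes the constant map in $\operatorname{Lip}(X,\mathcal{A})$ whose value is the unit of $\mathcal{A}$. A unital factor $C^*$-algebra is a unital $C^*$-algebra $\mathcal{A}$ with trivial center, i.e. the set of elements of $\mathcal{A}$ commuting with every element of $\mathcal{A}$ is $\mathbb{C}1$. A map $\psi$ is unital if $\psi(1)=1$. A surjective isometry between metric spaces is a surjective distance-preserving map. *)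

(* Defs.v *)
From HB Require Import structures.
From mathcomp Require Import all_boot all_order all_algebra.
From mathcomp Require Import complex.
From mathcomp Require Import all_classical all_reals all_analysis.

Set Implicit Arguments.
Unset Strict Implicit.
Unset Printing Implicit Defensive.

Import Order.TTheory GRing.Theory Num.Theory.
Import numFieldNormedType.Exports.

Local Open Scope classical_set_scope.
Local Open Scope ring_scope.

HB.mixin Record Metric_isCompact (R : realType) X & Metric R X := {
  metric_nonempty : [set: X] !=set0;
  metric_compact : compact [set: X]
}.

#[short(type="compactMetricType")]
HB.structure Definition CompactMetric (R : realType) :=
  {X of Metric R X & Metric_isCompact R X}.

(* The product and unit are fields rather than inherited from algType R[i]:
   normed modules over R[i] and rings have numDomainType as their only declared
   common substructure, which rules out a joint HB structure. The algType R[i]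
   instance is declared right after. *)
HB.mixin Record isCStarAlgebra (R : realType) A & CompleteNormedModule R[i] A := {
  cstar_one : A;
  cstar_mul : A -> A -> A;
  star : A -> A;
  cstar_mulA : associative cstar_mul;
  cstar_mul1l : left_id cstar_one cstar_mul;
  cstar_mul1r : right_id cstar_one cstar_mul;
  cstar_mulDl : left_distributive cstar_mul +%R;
  cstar_mulDr : right_distributive cstar_mul +%R;
  cstar_one_neq0 : cstar_one != 0;
  cstar_scaleAl : forall (c : R[i]) (a b : A),
    c *: cstar_mul a b = cstar_mul (c *: a) b;
  cstar_scaleAr : forall (c : R[i]) (a b : A),
    c *: cstar_mul a b = cstar_mul a (c *: b);
  starD : forall a b : A, star (a + b) = star a + star b;
  starZ : forall (c : R[i]) (a : A), star (c *: a) = c^* *: star a;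
  starM : forall a b : A, star (cstar_mul a b) = cstar_mul (star b) (star a);
  starK : involutive star;
  cstar_normM : forall a b : A, `|cstar_mul a b| <= `|a| * `|b|;
  cstar_normE : forall a : A, `|cstar_mul (star a) a| = `|a| ^+ 2
}.

#[short(type="cstarAlgType")]
HB.structure Definition CStarAlgebra (R : realType) :=
  {A of CompleteNormedModule R[i] A & isCStarAlgebra R A}.

HB.instance Definition _ (R : realType) (A : cstarAlgType R) :=
  GRing.Zmodule_isNzRing.Build (CStarAlgebra.sort A)
    (@cstar_mulA R A) (@cstar_mul1l R A) (@cstar_mul1r R A)
    (@cstar_mulDl R A) (@cstar_mulDr R A) (@cstar_one_neq0 R A).

HB.instance Definition _ (R : realType) (A : cstarAlgType R) :=
  GRing.Lmodule_isLalgebra.Build R[i] (CStarAlgebra.sort A)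
    (@cstar_scaleAl R A).

HB.instance Definition _ (R : realType) (A : cstarAlgType R) :=
  GRing.Lalgebra_isAlgebra.Build R[i] (CStarAlgebra.sort A)
    (@cstar_scaleAr R A).

Definition cstar_center (R : realType) (A : cstarAlgType R) : set A :=
  [set z | forall a : A, z * a = a * z].
Arguments cstar_center {R} A.

Definition is_factor (R : realType) (A : cstarAlgType R) : Prop :=
  cstar_center A = range (fun c : R[i] => c%:A).

(* Norms of complex normed modules are nonnegative elements of R[i]; this is
   the same norm, as an element of R. *)
Definition rnorm (R : realType) (E : normedModType R[i]) (v : E) : R :=
  complex.Re `|v|.

Section RNorm.
Context {R : realType} {E : normedModType R[i]}.
Implicit Types v w : E.

Lemma rnormE v : `|v| = (rnorm v)%:C%C.
Proof.
rewrite /rnorm; have : 0 <= `|v| by [].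
by case: `|v| => a b; rewrite lecE /= => /andP[/eqP -> _].
Qed.

Lemma rnorm_ge0 v : 0 <= rnorm v.
Proof. by rewrite -lecR -rnormE (normr_ge0 v). Qed.

Lemma ler_rnormD v w : rnorm (v + w) <= rnorm v + rnorm w.
Proof. by rewrite -lecR rmorphD /= -!rnormE ler_normD. Qed.

Lemma complex_normE (c : R[i]) : `|c| = (complex.Re `|c|)%:C%C.
Proof.
have : 0 <= `|c| by [].
by case: `|c| => a b; rewrite lecE /= => /andP[/eqP ->].
Qed.

Lemma Re_norm_ge0 (c : R[i]) : 0 <= complex.Re `|c|.
Proof. by rewrite -lecR -complex_normE (normr_ge0 c). Qed.

Lemma rnormZ (c : R[i]) v : rnorm (c *: v) = complex.Re `|c| * rnorm v.
Proof. by rewrite {1}/rnorm normrZ complex_normE rnormE -rmorphM. Qed.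

Lemma rnorm0_eq0 v : rnorm v = 0 -> v = 0.
Proof. by move=> v0; apply/normr0_eq0; rewrite rnormE v0. Qed.

End RNorm.

Section LipschitzMaps.
Context {R : realType} {X : compactMetricType R} {E : normedModType R[i]}.
Implicit Types (F G : X -> E).

Definition lip_quotients F : set R :=
  [set rnorm (F p.1 - F p.2) / mdist p.1 p.2 | p in [set p | p.1 != p.2]].

(* sup set0 = 0, so lip_const F = 0 when X is a single point. *)
Definition lip_const F : R := sup (lip_quotients F).

Definition sup_norm F : R := sup (range (fun x => rnorm (F x))).

Definition is_lip : {pred X -> E} :=
  [pred F | `[< has_ubound (lip_quotients F) >]].

Lemma is_lipP F : reflect
  (exists2 k : R, 0 <= k & forall x y, rnorm (F x - F y) <= k * mdist x y)
  (F \in is_lip).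
Proof.
rewrite inE; apply: (iffP (asboolP _)) => [[k kF]|[k k0 kF]].
  exists (Num.max k 0) => [|x y]; first by rewrite le_max lexx orbT.
  have [->|xy] := eqVneq x y.
    by rewrite subrr mdistxx mulr0 /rnorm normr0.
  rewrite -ler_pdivrMr ?mdist_gt0// le_max; apply/orP; left.
  by apply: kF; exists (x, y).
exists k => _ [[x y] /= xy <-].
by rewrite ler_pdivrMr ?mdist_gt0.
Qed.

Lemma is_lip_submod_closed : submod_closed is_lip.
Proof.
split=> [|c F G /is_lipP[k k0 kF] /is_lipP[l l0 lG]].
  by apply/is_lipP; exists 0 => // x y; rewrite subrr mul0r /rnorm normr0.
have c0 := Re_norm_ge0 c.
apply/is_lipP; exists (complex.Re `|c| * k + l) => [|x y].
  by rewrite addr_ge0 ?mulr_ge0.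
rewrite (_ : _ - _ = c *: (F x - F y) + (G x - G y)); last first.
  by rewrite scalerBr /= opprD addrACA.
rewrite (le_trans (ler_rnormD _ _))// mulrDl lerD// rnormZ -mulrA.
exact: ler_wpM2l.
Qed.

HB.instance Definition _ :=
  GRing.isSubmodClosed.Build R[i] (X -> E) is_lip is_lip_submod_closed.

Lemma is_lip_cst (e : E) : cst e \in is_lip.
Proof. by apply/is_lipP; exists 0 => // x y; rewrite subrr mul0r /rnorm normr0. Qed.

End LipschitzMaps.

Record Lip (R : realType) (X : compactMetricType R) (E : normedModType R[i]) := {
  lip_fun :> X -> E;
  lip_funP : lip_fun \in is_lip
}.

Section LipSpace.
Context {R : realType} {X : compactMetricType R} {E : normedModType R[i]}.
Implicit Types F G : Lip X E.

HB.instance Definition _ := [isSub for @lip_fun R X E].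
HB.instance Definition _ := [Choice of Lip X E by <:].
HB.instance Definition _ :=
  [SubChoice_isSubLmodule of Lip X E by <:].

Definition lip_cst (e : E) : Lip X E := Build_Lip (is_lip_cst e).

Lemma mdist_bounded (x0 : X) : exists M : R, forall x : X, mdist x0 x <= M.
Proof.
have /compact_near_coveringP/(_ R (pinfty_nbhs R) (fun M x => mdist x0 x <= M)) :=
  @metric_compact R X.
case=> [x _|M [_ HM]].
- exists (ball x 1, [set M | mdist x0 x + 1 < M]) => /=.
    by split; [exact: (@nbhsx_ballx R X x 1 ltr01) | apply: nbhs_pinfty_gt; exact: num_real].
  move=> [y M] /= [xy lM]; apply: (le_trans (metric_triangle x0 x y)).
  by rewrite (le_trans _ (ltW lM))// lerD2l ltW//; move: xy; rewrite ballEmdist.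
- by exists (M + 1) => x; apply: (HM (M + 1)) => //; rewrite ltrDl.
Qed.

Lemma has_sup_norm F : has_sup (range (fun x => rnorm (F x))).
Proof.
have [x0 _] := @metric_nonempty R X.
split; first by exists (rnorm (F x0)), x0.
have [k k0 kF] := is_lipP _ (lip_funP F); have [M MX] := mdist_bounded x0.
exists (k * M + rnorm (F x0)) => _ [x _ <-] /=.
rewrite -[F x](subrK (F x0)) (le_trans (ler_rnormD _ _))// lerD2r.
by rewrite (le_trans (kF _ _))// ler_wpM2l// metric_sym.
Qed.

Lemma sup_norm_ub F x : rnorm (F x) <= sup_norm F.
Proof. by apply: (ub_le_sup (proj2 (has_sup_norm F))); exists x. Qed.

Lemma lip_const_ub F x y : rnorm (F x - F y) <= lip_const F * mdist x y.
Proof.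
have [->|xy] := eqVneq x y; first by rewrite subrr mdistxx mulr0 /rnorm normr0.
rewrite -ler_pdivrMr ?mdist_gt0//; apply: ub_le_sup; last by exists (x, y).
exact/asboolP/lip_funP.
Qed.

Lemma sup_norm_le F (M : R) : (forall x, rnorm (F x) <= M) -> sup_norm F <= M.
Proof.
move=> FM; apply: ge_sup; first exact: (proj1 (has_sup_norm F)).
by move=> _ [x _ <-]; exact: FM.
Qed.

Lemma lip_const_le F (M : R) : 0 <= M ->
  (forall x y, rnorm (F x - F y) <= M * mdist x y) -> lip_const F <= M.
Proof.
move=> M0 FM; rewrite /lip_const.
have [->|/set0P Q0] := eqVneq (lip_quotients F) set0; first by rewrite sup0.
by apply: ge_sup => // _ [[x y] /= xy <-]; rewrite ler_pdivrMr ?mdist_gt0.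
Qed.

Lemma sup_norm_ge0 F : 0 <= sup_norm F.
Proof.
have [x0 _] := @metric_nonempty R X.
exact: le_trans (rnorm_ge0 (F x0)) (sup_norm_ub F x0).
Qed.

Lemma lip_const_ge0 F : 0 <= lip_const F.
Proof.
rewrite /lip_const.
have [->|/set0P[q Qq]] := eqVneq (lip_quotients F) set0; first by rewrite sup0.
apply: (@le_trans _ _ q); last first.
  by apply: ub_le_sup => //; exact/asboolP/lip_funP.
case: Qq => -[x y] /= _ <-; by rewrite divr_ge0 ?rnorm_ge0 ?mdist_ge0.
Qed.

Definition lip_norm F : R := sup_norm F + lip_const F.

Lemma ler_lip_normD F G : lip_norm (F + G) <= lip_norm F + lip_norm G.
Proof.
rewrite /lip_norm addrACA lerD//.
  apply: sup_norm_le => x; apply: (le_trans (ler_rnormD _ _)).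
  by rewrite lerD ?sup_norm_ub.
apply: lip_const_le => [|x y]; first by rewrite addr_ge0 ?lip_const_ge0.
rewrite (_ : _ - _ = (F x - F y) + (G x - G y)); last by rewrite /= opprD addrACA.
by rewrite (le_trans (ler_rnormD _ _))// mulrDl lerD ?lip_const_ub.
Qed.

Lemma ler_lip_normZ (c : R[i]) F : lip_norm (c *: F) <= complex.Re `|c| * lip_norm F.
Proof.
have c0 := Re_norm_ge0 c.
rewrite /lip_norm mulrDr lerD//.
  by apply: sup_norm_le => x; rewrite rnormZ ler_wpM2l ?sup_norm_ub.
apply: lip_const_le => [|x y]; first by rewrite mulr_ge0 ?lip_const_ge0.
rewrite (_ : _ - _ = c *: (F x - F y)); last by rewrite scalerBr.
by rewrite rnormZ -mulrA ler_wpM2l ?lip_const_ub.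
Qed.

Lemma lip_norm0_eq0 F : lip_norm F = 0 -> F = 0.
Proof.
move=> /eqP; rewrite paddr_eq0 ?sup_norm_ge0 ?lip_const_ge0// => /andP[/eqP F0 _].
apply/val_inj/funext => x; apply/rnorm0_eq0/eqP.
by rewrite eq_le rnorm_ge0 andbT -F0 sup_norm_ub.
Qed.

Let normC F : R[i] := (lip_norm F)%:C%C.

Let normC_triangle F G : normC (F + G) <= normC F + normC G.
Proof. by rewrite -rmorphD lecR ler_lip_normD. Qed.

Let normCZ (c : R[i]) F : normC (c *: F) = `|c| * normC F.
Proof.
rewrite complex_normE -rmorphM; congr (_%:C)%C.
apply/eqP; rewrite eq_le ler_lip_normZ andTb.
have [->|c0] := eqVneq c 0.
  by rewrite normr0 mul0r addr_ge0 ?sup_norm_ge0 ?lip_const_ge0.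
have cp : 0 < complex.Re `|c| by rewrite -ltcR -complex_normE normr_gt0.
rewrite mulrC -ler_pdivlMr// mulrC -{1}[F](scalerK c0).
rewrite (le_trans (ler_lip_normZ _ _))// normfV.
by rewrite [X in complex.Re X^-1]complex_normE -fmorphV.
Qed.

Let normC0_eq0 F : normC F = 0 -> F = 0.
Proof. by move=> /complexI/lip_norm0_eq0. Qed.

HB.instance Definition _ :=
  Lmodule_isNormed.Build R[i] (Lip X E) normC_triangle normCZ normC0_eq0.

Lemma lip_normE F : `|F| = (sup_norm F + lip_const F)%:C%C.
Proof. by []. Qed.

End LipSpace.

Definition surjective (S T : Type) (f : S -> T) : Prop :=
  forall y, exists x, f x = y.

Definition surjective_linear_isometry (R : realType) (V W : normedModType R[i])
    (f : V -> W) : Prop :=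
  [/\ linear f, (forall v w, `|f v - f w| = `|v - w|) & surjective f].

Definition surjective_isometry (R : realType) (X Y : metricType R)
    (f : X -> Y) : Prop :=
  (forall x y, mdist (f x) (f y) = mdist x y) /\ surjective f.

(* Main.v *)
(* A unital isometry U preserves F |-> |F + c|_oo + L(F) for all scalars c. For
   self-adjoint F with U F = G + i H, letting c grow along the real and the
   imaginary axes gives |F|_oo + r <= |G|_oo and |H|_oo <= r, where
   r = L(F) - L(U F). Playing these inequalities for U against those for its
   inverse forces r = 0 and H = 0, so U and its inverse preserve self-adjoint
   maps, their sup norm shifted by scalars, hence positivity, and their
   Lipschitz constant; in particular they preserve constants. Kadison's
   inequality for U and its inverse makes U a Jordan map for the pointwise
   product, so U maps scalar-valued maps to central-valued maps, which are
   scalar-valued because the algebras are factors. At each y, f |-> (U f)(y) is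
   then a multiplicative positive functional on real Lipschitz functions, hence
   evaluation at a point phi y by compactness, and F - F(phi y) is dominated by
   L(F) d(phi y, .), so that (U F)(y) = (U (cst F(phi y)))(y).

   The order theory of C*-algebras needed for this is derived from the norm:
   square roots come from a convergent iteration, and positivity of x^* x from
   Kaplansky's argument. *)

Require Import Defs.
From HB Require Import structures.
From mathcomp Require Import all_boot all_order all_algebra.
From mathcomp Require Import complex ring lra.
From mathcomp Require Import all_classical all_reals all_analysis.

Set Implicit Arguments.
Unset Strict Implicit.
Unset Printing Implicit Defensive.

Import Order.TTheory GRing.Theory Num.Theory.
Import numFieldNormedType.Exports.

Local Open Scope ring_scope.

(** * A decision procedure for identities in noncommutative algebras *)

Inductive nc_term (K : Type) : Type :=
  | NCvar of nat | NC0 | NC1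
  | NCadd of nc_term K & nc_term K
  | NCopp of nc_term K
  | NCmul of nc_term K & nc_term K
  | NCscale of K & nc_term K.
Arguments NCvar {K}. Arguments NC0 {K}. Arguments NC1 {K}.

(* Normal forms are lists of monomials: a coefficient and a word in the
   variables. *)
Section NCNormalForm.
Context {K : comNzRingType} {A : algType K}.

Fixpoint nc_eval (env : seq A) (e : nc_term K) : A :=
  match e with
  | NCvar n => nth 0 env n
  | NC0 => 0
  | NC1 => 1
  | NCadd e f => nc_eval env e + nc_eval env f
  | NCopp e => - nc_eval env e
  | NCmul e f => nc_eval env e * nc_eval env f
  | NCscale c e => c *: nc_eval env e
  end.

(** Private copies of concatenation and of the equality tests let [cbv] compute normal forms from a
    fixed list of constants while coefficient arithmetic stays folded. *)
Fixpoint nc_app T (s t : seq T) := if s is x :: s' then x :: nc_app s' t else t.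

Fixpoint nc_scale (c : K) (w : seq nat) (l : seq (K * seq nat)) :=
  if l is (d, v) :: l' then (c * d, nc_app w v) :: nc_scale c w l' else [::].

Fixpoint nc_mul (l m : seq (K * seq nat)) :=
  if l is (c, w) :: l' then nc_app (nc_scale c w m) (nc_mul l' m) else [::].

Fixpoint nc_nf (e : nc_term K) : seq (K * seq nat) :=
  match e with
  | NCvar n => [:: (1, [:: n])]
  | NC0 => [::]
  | NC1 => [:: (1, [::])]
  | NCadd e f => nc_app (nc_nf e) (nc_nf f)
  | NCopp e => nc_scale (-1) [::] (nc_nf e)
  | NCmul e f => nc_mul (nc_nf e) (nc_nf f)
  | NCscale c e => nc_scale c [::] (nc_nf e)
  end.

Fixpoint nc_eqn (m n : nat) :=
  match m, n with
  | 0%N, 0%N => true | S m, S n => nc_eqn m n | _, _ => false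
  end.

Fixpoint nc_eqw (v w : seq nat) :=
  match v, w with
  | [::], [::] => true
  | m :: v, n :: w => if nc_eqn m n then nc_eqw v w else false
  | _, _ => false
  end.

Fixpoint nc_insert (c : K) (w : seq nat) (l : seq (K * seq nat)) :=
  if l is (d, v) :: l' then
    if nc_eqw w v then (c + d, v) :: l' else (d, v) :: nc_insert c w l'
  else [:: (c, w)].

Fixpoint nc_collect (l : seq (K * seq nat)) :=
  if l is (c, w) :: l' then nc_insert c w (nc_collect l') else [::].

Fixpoint nc_zero (l : seq (K * seq nat)) : Prop :=
  if l is (c, _) :: l' then c = 0 /\ nc_zero l' else True.

Let word (env : seq A) (w : seq nat) : A := \prod_(i <- w) nth 0 env i.
Let val (env : seq A) (l : seq (K * seq nat)) : A :=
  \sum_(cw <- l) cw.1 *: word env cw.2.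

Let nc_appE T (s t : seq T) : nc_app s t = s ++ t.
Proof. by elim: s => //= x s ->. Qed.

Let nc_scaleE env c w l : val env (nc_scale c w l) = (c *: word env w) * val env l.
Proof.
elim: l => [|[d v] l IHl]; rewrite /val /= ?big_nil ?mulr0// !big_cons.
by rewrite -!/(val _ _) IHl nc_appE /word /= big_cat /= mulrDr -!scalerAl -!scalerAr scalerA.
Qed.

Let nc_mulE env l m : val env (nc_mul l m) = val env l * val env m.
Proof.
elim: l => [|[c w] l IHl]; first by rewrite /val /= !big_nil mul0r.
by rewrite /= nc_appE /val big_cat big_cons /= -!/(val _ _) IHl nc_scaleE mulrDl.
Qed.

Let nc_nfE env e : val env (nc_nf e) = nc_eval env e.
Proof.
elim: e => [n|||e IHe f IHf|e IHe|e IHe f IHf|c e IHe] /=.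
- by rewrite /val big_seq1 /word /= big_seq1 scale1r.
- by rewrite /val big_nil.
- by rewrite /val big_seq1 /word /= big_nil scale1r.
- by rewrite nc_appE /val big_cat /= -!/(val _ _) IHe IHf.
- by rewrite nc_scaleE IHe /word big_nil scaleN1r mulN1r.
- by rewrite nc_mulE IHe IHf.
- by rewrite nc_scaleE IHe /word big_nil -scalerAl mul1r.
Qed.

Let nc_eqwP v w : nc_eqw v w -> v = w.
Proof.
have eqn : forall m n, nc_eqn m n -> m = n by elim=> [|m IHm] [|n] //= /IHm ->.
elim: v w => [|m v IHv] [|n w] //=.
by case: ifP => // /eqn -> /IHv ->.
Qed.

Let nc_insertE env c w l : val env (nc_insert c w l) = c *: word env w + val env l.
Proof.
elim: l => [|[d v] l IHl] /=; first by rewrite /val big_seq1 big_nil addr0.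
case: ifP => [/nc_eqwP ->|_]; rewrite /val !big_cons /= -!/(val _ _).
  by rewrite scalerDl addrA.
by rewrite IHl addrCA.
Qed.

Let nc_collectE env l : val env (nc_collect l) = val env l.
Proof.
elim: l => [|[c w] l IHl] //=.
by rewrite nc_insertE IHl {2}/val big_cons.
Qed.

(** Collecting equal words of the difference leaves one equation in [K] per word; [ncring] reduces a
    goal to these, for [ring] or [field] to close. Atoms are treated as free, so commutation
    relations must be rewritten beforehand. *)
Lemma nc_eqP env e f :
  nc_zero (nc_collect (nc_nf (NCadd e (NCopp f)))) ->
  nc_eval env e = nc_eval env f.
Proof.
have zero l : nc_zero l -> val env l = 0.
  elim: l => [|[c w] l IHl] /=; first by rewrite /val big_nil.
  by case=> c0 /IHl; rewrite /val big_cons c0 scale0r add0r.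
by move=> /zero; rewrite nc_collectE nc_nfE /= => /eqP; rewrite subr_eq0 => /eqP.
Qed.

End NCNormalForm.

Ltac nc_mem a l :=
  lazymatch l with
  | nil => false
  | a :: _ => true
  | _ :: ?l' => nc_mem a l'
  end.

Ltac nc_pos a l :=
  lazymatch l with
  | a :: _ => constr:(0%N)
  | _ :: ?l' => let n := nc_pos a l' in constr:(S n)
  end.

Ltac nc_atoms l e :=
  lazymatch e with
  | @GRing.zero _ => l
  | @GRing.one _ => l
  | GRing.add ?a ?b => let l' := nc_atoms l a in nc_atoms l' b
  | GRing.opp ?a => nc_atoms l a
  | GRing.mul ?a ?b => let l' := nc_atoms l a in nc_atoms l' b
  | GRing.scale _ ?a => nc_atoms l a
  | _ => lazymatch nc_mem e l with
         | true => l
         | false => constr:(e :: l)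
         end
  end.

Ltac nc_reify K l e :=
  lazymatch e with
  | @GRing.zero _ => constr:(@NC0 K)
  | @GRing.one _ => constr:(@NC1 K)
  | GRing.add ?a ?b =>
    let a' := nc_reify K l a in let b' := nc_reify K l b in
    constr:(@NCadd K a' b')
  | GRing.opp ?a => let a' := nc_reify K l a in constr:(@NCopp K a')
  | GRing.mul ?a ?b =>
    let a' := nc_reify K l a in let b' := nc_reify K l b in
    constr:(@NCmul K a' b')
  | GRing.scale ?c ?a =>
    let a' := nc_reify K l a in constr:(@NCscale K c a')
  | _ => let n := nc_pos e l in constr:(@NCvar K n)
  end.

Ltac nc_normalize K A :=
  lazymatch goal with
  | |- @eq _ ?a ?b =>
    let l := nc_atoms (@nil A) a in let l := nc_atoms l b in
    let a' := nc_reify K l a in let b' := nc_reify K l b in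
    apply: (@nc_eqP K A l a' b');
    cbv [nc_nf nc_mul nc_scale nc_app nc_collect nc_insert nc_eqn nc_eqw nc_zero];
    repeat split
  end.

(** * Norm and involution *)

Local Notation "t %:c" := (real_complex _ t) (at level 2, format "t %:c").

Ltac ncring A :=
  let K := lazymatch type of A with cstarAlgType ?R => constr:(R[i] : comNzRingType) end in
  nc_normalize K (A : algType K).

Section CStarNorm.
Context {R : realType} {A : cstarAlgType R}.
Implicit Types (a b c x y p q : A) (r s t : R).

Lemma rnorm0 : rnorm (0 : A) = 0.
Proof. by rewrite /rnorm normr0. Qed.

Lemma rnormN a : rnorm (- a) = rnorm a.
Proof. by rewrite /rnorm normrN. Qed.

Lemma rnormZr t a : rnorm (t%:c *: a) = `|t| * rnorm a.
Proof.
rewrite rnormZ normc_def /= expr0n /= addr0 sqrtr_sqr.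
by [].
Qed.

Lemma rnormZp t a : 0 <= t -> rnorm (t%:c *: a) = t * rnorm a.
Proof. by move=> t0; rewrite rnormZr ger0_norm. Qed.

Lemma rnormZi a : rnorm ('i *: a) = rnorm a.
Proof. by rewrite rnormZ normCi /= mul1r. Qed.

Lemma rnormM a b : rnorm (a * b) <= rnorm a * rnorm b.
Proof. by rewrite -lecR rmorphM /= -!rnormE; exact: cstar_normM. Qed.

Lemma rnorm_starM a : rnorm (star a * a) = rnorm a ^+ 2.
Proof. by apply: (@complexI R); rewrite rmorphXn /= -!rnormE; exact: cstar_normE. Qed.

Lemma starN a : star (- a) = - star a.
Proof.
rewrite -scaleN1r starZ rmorphN rmorph1 scaleN1r.
by [].
Qed.

Lemma starB a b : star (a - b) = star a - star b.
Proof. by rewrite starD starN. Qed.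

Lemma star0 : star (0 : A) = 0.
Proof. by rewrite -[0 in LHS](subrr 0) starB subrr. Qed.

Lemma starMr a b : star (a * b) = star b * star a.
Proof. exact: starM. Qed.

Lemma star1 : star (1 : A) = 1.
Proof.
by have := starMr (star 1) 1; rewrite mulr1 starK mulr1 => <-.
Qed.

Lemma starZr t a : star (t%:c *: a) = t%:c *: star a.
Proof. by rewrite starZ; congr (_ *: _); rewrite conj_Creal// complex_real. Qed.

Lemma starZi a : star ('i *: a) = - ('i *: star a).
Proof. by rewrite starZ conjCi scaleNr. Qed.

(** Cancel [|a|] in [|a|^2 = |a^* a| <= |a^*| |a|]. *)
Lemma rnorm_star_le a : rnorm a <= rnorm (star a).
Proof.
have [->|a0] := eqVneq (rnorm a) 0; first exact: rnorm_ge0.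
have a_gt0 : 0 < rnorm a by rewrite lt_neqAle eq_sym a0 rnorm_ge0.
by rewrite -(ler_pM2r a_gt0) -expr2 -rnorm_starM rnormM.
Qed.

Lemma rnorm_star a : rnorm (star a) = rnorm a.
Proof.
by apply/eqP; rewrite eq_le rnorm_star_le andbT -{2}(starK a) rnorm_star_le.
Qed.

Lemma rnorm_sqr a : star a = a -> rnorm (a * a) = rnorm a ^+ 2.
Proof. by move=> aE; rewrite -{1}aE rnorm_starM. Qed.

Lemma rnorm1 : rnorm (1 : A) = 1.
Proof.
have := rnorm_sqr star1; rewrite mulr1 expr2 => /eqP.
rewrite -subr_eq0 -{1}[rnorm (1 : A)]mulr1 -mulrBr mulf_eq0 => /orP[/eqP/rnorm0_eq0/eqP|].
  by rewrite oner_eq0.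
by rewrite subr_eq0 => /eqP.
Qed.

Lemma rnormr t : rnorm (t%:c%:A : A) = `|t|.
Proof. by rewrite rnormZr rnorm1 mulr1. Qed.

Lemma starr t : star (t%:c%:A : A) = t%:c%:A.
Proof. by rewrite starZr star1. Qed.

Lemma rnorm_eq0_le a (k : R) : (forall e : R, 0 < e -> rnorm a <= k * e) -> a = 0.
Proof.
move=> ak; apply/rnorm0_eq0/eqP; rewrite eq_le rnorm_ge0 andbT leNgt.
apply/negP => a0; have k0 : 0 < k.
  by have := ak 1 ltr01; rewrite mulr1; exact: lt_le_trans.
have := ak (rnorm a / (2 * k)) (divr_gt0 a0 (mulr_gt0 (ltr0Sn R 1) k0)).
rewrite (_ : k * _ = rnorm a / 2); first by lra.
by field; rewrite gt_eqF.
Qed.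

End CStarNorm.

(** * Square roots *)

Section SquareRoot.
Local Open Scope classical_set_scope.
Context {R : realType} {A : cstarAlgType R}.
Implicit Types (a b c x y p q : A) (r s t : R).

(* The iterates increase to the solution [1 - sqrt (1 - y)] of
   [w = (y + w * w) / 2]; the scalar iterates [sqrt_rate] at [y = 1] control
   their speed of convergence. *)
Fixpoint sqrt_iter y (n : nat) : A :=
  if n is n'.+1 then 2^-1%:c *: (y + sqrt_iter y n' * sqrt_iter y n') else 0.

Fixpoint sqrt_rate (n : nat) : R :=
  if n is n'.+1 then (1 + sqrt_rate n' ^+ 2) / 2 else 0.

Lemma sqrt_rate_bound n :
  [/\ 0 <= sqrt_rate n, sqrt_rate n <= 1 & 1 - sqrt_rate n <= 2 / n.+2%:R].
Proof.
elim: n => [|n [s0 s1 sn]] /=; first by split; [lra|lra|rewrite divff ?subr0].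
set s := sqrt_rate n in s0 s1 sn *; split; [nra|nra|].
(* In terms of [d = 1 - s] the recursion is [d - d^2 / 2], increasing for [d <= 1], whence the decay
   like [2 / (n + 2)]. *)
have -> : 1 - (1 + s ^+ 2) / 2 = (1 - s) - (1 - s) ^+ 2 / 2 by field.
have n0 : 0 <= n%:R :> R by [].
move: sn; rewrite -[n.+3]addn3 -[n.+2]addn2 !natrD.
set m := n%:R in n0 *.
rewrite ler_pdivlMr; last lra.
rewrite ler_pdivlMr; last lra.
nra.
Qed.

Lemma rate_small (e : R) : 0 < e -> exists n : nat, 2 / n.+2%:R < e.
Proof.
move=> e0; have [n] := ltr_add_invr (divr_gt0 e0 (ltr0Sn R 1)).
rewrite add0r ltr_pdivlMr// mulrC => ne; exists n; apply: le_lt_trans ne.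
by rewrite ler_wpM2l// lef_pV2 ?posrE// ler_nat.
Qed.

Lemma sqrt_iter_comm y c n : c * y = y * c -> c * sqrt_iter y n = sqrt_iter y n * c.
Proof.
move=> cy; elim: n => [|n IHn] /=; first by rewrite mulr0 mul0r.
rewrite -scalerAr -scalerAl mulrDr mulrDl cy; congr (_ *: (_ + _)).
by rewrite mulrA IHn -mulrA IHn mulrA.
Qed.

Lemma sqrt_iter_star y n : star y = y -> star (sqrt_iter y n) = sqrt_iter y n.
Proof.
move=> yE; elim: n => [|n IHn] /=; first exact: star0.
by rewrite starZr starD starMr IHn yE.
Qed.

(** Majorization by the scalar recursion. For the increments, the iterates commute, so the next
    increment factors as [(v - w) (v + w) / 2]. *)
Lemma sqrt_iter_norm y n : rnorm y <= 1 ->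
  rnorm (sqrt_iter y n) <= sqrt_rate n /\
  rnorm (sqrt_iter y n.+1 - sqrt_iter y n) <= sqrt_rate n.+1 - sqrt_rate n.
Proof.
move=> y1; elim: n => [|n [IHn IHd]].
  split; rewrite /= ?rnorm0// mulr0 addr0 subr0 rnormZr.
  rewrite ger0_norm; last lra.
  by lra.
have [s0 s1 _] := sqrt_rate_bound n; have [t0 t1 _] := sqrt_rate_bound n.+1.
set w := sqrt_iter y n in IHn IHd *; set v := sqrt_iter y n.+1 in IHd *.
set s := sqrt_rate n in s0 s1 IHn IHd *.
have vE : v = 2^-1%:c *: (y + w * w) by [].
have v2E : sqrt_iter y n.+2 = 2^-1%:c *: (y + v * v) by [].
have tE : sqrt_rate n.+1 = (1 + s ^+ 2) / 2 by [].
have t2E : sqrt_rate n.+2 = (1 + sqrt_rate n.+1 ^+ 2) / 2 by [].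
set t := sqrt_rate n.+1 in t0 t1 IHd tE t2E *.
have half : `|2^-1 : R| = 2^-1 by rewrite ger0_norm//; lra.
have v_le : rnorm v <= t.
  rewrite vE rnormZr half tE; have := ler_rnormD y (w * w).
  have := rnormM w w; have := rnorm_ge0 w; nra.
split=> //; rewrite v2E t2E.
have wv : w * v = v * w by apply: sqrt_iter_comm; rewrite sqrt_iter_comm.
have -> : 2^-1%:c *: (y + v * v) - v = 2^-1%:c *: ((v - w) * (v + w)).
  rewrite {3}vE mulrDr !mulrBl wv.
  by ncring A; ring.
rewrite rnormZr half; have := rnormM (v - w) (v + w); have := ler_rnormD v w.
have := rnorm_ge0 (v - w); have := rnorm_ge0 (v + w).
nra.
Qed.

(** The increments telescope to at most [sqrt_rate m - sqrt_rate n <= 1 - sqrt_rate n]. *)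
Lemma sqrt_iter_cauchy y m n : rnorm y <= 1 -> (n <= m)%N ->
  rnorm (sqrt_iter y m - sqrt_iter y n) <= 2 / n.+2%:R.
Proof.
move=> y1 /subnK <-.
have [_ _] := sqrt_rate_bound n; apply: le_trans.
have [_ sm _] := sqrt_rate_bound (m - n + n)%N.
apply: (@le_trans _ _ (sqrt_rate (m - n + n)%N - sqrt_rate n)); last lra.
elim: (m - n)%N => [|k IHk]; first by rewrite !subrr rnorm0.
have [_] := sqrt_iter_norm (k + n)%N y1; rewrite addSn.
set u := sqrt_iter _ _.+1; set v := sqrt_iter _ (k + n)%N in IHk *.
set w := sqrt_iter y n in IHk *.
have -> : u - w = (u - v) + (v - w) by rewrite addrA subrK.
have := ler_rnormD (u - v) (v - w); lra.
Qed.

Lemma sqrt_iter_cvg y : rnorm y <= 1 ->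
  exists w, forall n, rnorm (w - sqrt_iter y n) <= 2 / n.+2%:R.
Proof.
move=> y1.
have gt0c (e : R[i]) : 0 < e -> exists2 r : R, 0 < r & e = r%:c.
  by case: e => a b; rewrite ltcE /= => /andP[/eqP -> a0]; exists a.
have cvgw : cvg (sqrt_iter y @ \oo).
  apply: cauchy_cvg; apply: cauchy_exP => _ /gt0c[e e0 ->].
  have [n ne] := rate_small e0.
  exists (sqrt_iter y n); exists n => // m /= nm.
  rewrite -ball_normE /= distrC rnormE ltcR.
  exact: le_lt_trans (sqrt_iter_cauchy y1 nm) ne.
have [w /cvgrPdist_lt wP] := (cvg_ex _).1 cvgw.
exists w => n; apply/ler_addgt0Pl => e e0.
have [N _ NP] : \forall m \near \oo, `|w - sqrt_iter y m| < e%:c.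
  by apply: wP; rewrite ltcR.
have /= := NP _ (leq_maxl N n); rewrite rnormE ltcR => we.
have nm := sqrt_iter_cauchy y1 (leq_maxr N n).
rewrite -[w in leLHS](subrK (sqrt_iter y (maxn N n))) -addrA.
by apply: (le_trans (ler_rnormD _ _)); rewrite lerD// ltW.
Qed.

(** The root is [q = 1 - w] with [w] the limit of the iterates. The bound on [1 - q] will make [q]
    positive, and the commutation clause stands in for functional calculus. *)
Lemma sqrt_one_sub y : star y = y -> rnorm y <= 1 ->
  exists q, [/\ star q = q, q * q = 1 - y, rnorm (1 - q) <= 1 &
                forall c, c * y = y * c -> c * q = q * c].
Proof.
move=> yE y1; have [w wP] := sqrt_iter_cvg y1.
have w1 : rnorm w <= 1.
  apply/ler_addgt0Pl => e e0; have [n ne] := rate_small e0.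
  have [iter_le _] := sqrt_iter_norm n y1; have [_ s1 _] := sqrt_rate_bound n.
  rewrite -[w](subrK (sqrt_iter y n)).
  move: ne (wP n); set d := 2 / _ => ne wd.
  have := ler_rnormD (w - sqrt_iter y n) (sqrt_iter y n).
  lra.
(* The properties of [w] below pass to the limit by bounding a defect by a multiple of
   [2 / (n + 2)]. *)
have approx x (k : R) : 0 <= k -> (forall n, rnorm x <= k * (2 / n.+2%:R)) -> x = 0.
  move=> k0 xk; apply: (@rnorm_eq0_le _ _ _ k) => e /rate_small[n ne].
  by apply: (le_trans (xk n)); rewrite ler_wpM2l// ltW.
have w_star : star w = w.
  apply/eqP; rewrite -subr_eq0; apply/eqP.
  apply: (approx _ 2) => // n; move: (wP n); set v := sqrt_iter y n; set d := 2 / _ => wv.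
  have -> : star w - w = star (w - v) - (w - v).
    by rewrite starB sqrt_iter_star// opprB addrA subrK.
  by have := ler_rnormD (star (w - v)) (- (w - v)); rewrite rnormN rnorm_star; lra.
have w_comm c : c * y = y * c -> c * w = w * c.
  move=> cy; apply/eqP; rewrite -subr_eq0; apply/eqP.
  apply: (approx _ (2 * rnorm c)) => [|n]; first by rewrite mulr_ge0 ?rnorm_ge0.
  move: (wP n) (sqrt_iter_comm n cy); set v := sqrt_iter y n; set d := 2 / _ => wv cv.
  have -> : c * w - w * c = c * (w - v) - (w - v) * c.
    by rewrite mulrBr mulrBl cv opprB addrA subrK.
  have := ler_rnormD (c * (w - v)) (- ((w - v) * c)); rewrite rnormN.
  have := rnormM c (w - v); have := rnormM (w - v) c; have := rnorm_ge0 c.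
  nra.
have w_fix : w + w = y + w * w.
  apply/eqP; rewrite -subr_eq0; apply/eqP.
  apply: (approx _ 4) => // n.
  have := wP n; have := wP n.+1; have [+ _] := sqrt_iter_norm n y1.
  have [_ + _] := sqrt_rate_bound n.
  set v := sqrt_iter y n; set u := sqrt_iter y n.+1 => s1 vs wu wv.
  have u2 : 2 / n.+3%:R <= 2 / n.+2%:R :> R.
    by rewrite ler_wpM2l// lef_pV2 ?posrE// ler_nat.
  move: (le_trans wu u2) wv; set d := 2 / _ => {}wu wv.
  (* As [2 u = y + v * v], the defect only involves [w - u] and [w - v]; with [w] and [v] in the
     unit ball it is at most [4 d]. *)
  have -> : w + w - (y + w * w) =
      (w - u) + (w - u) - ((w - v) * w + v * (w - v)).
    rewrite /u /= -/v.
    by ncring A; field.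
  have := ler_rnormD (w - u + (w - u)) (- ((w - v) * w + v * (w - v))).
  rewrite rnormN.
  have := ler_rnormD (w - u) (w - u).
  have := ler_rnormD ((w - v) * w) (v * (w - v)).
  have := rnormM (w - v) w; have := rnormM v (w - v).
  have := rnorm_ge0 w; have := rnorm_ge0 v; have := rnorm_ge0 (w - v).
  nra.
exists (1 - w); split.
- by rewrite starB star1 w_star.
- apply/eqP; rewrite -subr_eq0; apply/eqP; transitivity (y + w * w - (w + w)).
    by ncring A; ring.
  by rewrite w_fix subrr.
- by rewrite opprB addrCA subrr addr0.
- by move=> c /w_comm cw; rewrite mulrBr mulrBl mulr1 mul1r cw.
Qed.

End SquareRoot.

(** * The positive cone *)

(* A self-adjoint element is positive when its spectrum lies in some disc of
   center [t] and radius [t]; stating this through the norm alone makes the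
   cone invariant under unital isometries. *)
Definition cpos (R : realType) (A : cstarAlgType R) (p : A) : Prop :=
  star p = p /\ exists2 t : R, 0 <= t & rnorm (t%:c%:A - p) <= t.

Section PositiveCone.
Context {R : realType} {A : cstarAlgType R}.
Implicit Types (a b c x y p q : A) (r s t : R).

(** With [q] the root of [1 - a^2], the element [u = a + i q] has [u^* u = a^2 + q^2 = 1]. Its
    imaginary part [q] then has norm at most 1, and so does [q^2]. *)
Lemma rnorm_one_sub_sqr a : star a = a -> rnorm a <= 1 -> rnorm (1 - a * a) <= 1.
Proof.
move=> aE a1.
have [||q [qE qq _ qC]] := @sqrt_one_sub R A (a * a).
- by rewrite starMr aE.
- by rewrite rnorm_sqr// exprn_ile1 ?rnorm_ge0.
have aq : a * q = q * a by apply: qC; rewrite mulrA.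
pose u := a + 'i *: q.
have uE : star u = a - 'i *: q by rewrite starD starZi aE qE.
have u1 : rnorm u <= 1.
  rewrite -(@ler_pXn2r _ 2) ?nnegrE ?rnorm_ge0// expr1n -rnorm_starM uE.
  have -> : (a - 'i *: q) * u = a * a + q * q.
    have iN1 : 'i * 'i = -1 :> R[i] by rewrite -expr2 sqrCi.
    rewrite /u mulrDl !mulrDr mulNr -!scalerAl -!scalerAr mulNr -scalerAl aq.
    by rewrite scalerN scalerA iN1 scaleN1r opprK addrA addrK.
  by rewrite qq addrCA subrr addr0 rnorm1.
have q1 : rnorm q <= 1.
  have -> : rnorm q = 2^-1 * rnorm (u - star u).
    have -> : u - star u = 2%:c *: ('i *: q).
      by rewrite uE /u; ncring A; rewrite ?rmorph_nat; ring.
    by rewrite rnormZr rnormZi ger0_norm// mulrA mulVf ?mul1r.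
  have := ler_rnormD u (- star u); rewrite rnormN rnorm_star; lra.
rewrite -qq; apply: (le_trans (rnormM _ _)).
have := rnorm_ge0 q; nra.
Qed.

Lemma rnorm_sub_sqr a t : star a = a -> rnorm a ^+ 2 <= t ->
  rnorm (t%:c%:A - a * a) <= t.
Proof.
move=> aE at2; have t0 : 0 <= t by apply: le_trans at2; rewrite sqr_ge0.
have [t_eq0|t_neq0] := eqVneq t 0.
  have /rnorm0_eq0 -> : rnorm a = 0.
    by apply/eqP; rewrite -sqrf_eq0 eq_le sqr_ge0 andbT -t_eq0.
  by rewrite mulr0 subr0 rnormr ger0_norm.
have s0 : 0 < Num.sqrt t by rewrite sqrtr_gt0 lt_neqAle eq_sym t_neq0.
have st : Num.sqrt t ^+ 2 = t by rewrite sqr_sqrtr.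
set s := Num.sqrt t in s0 st; set b := (s^-1)%:c *: a.
have bE : star b = b by rewrite starZr aE.
have b1 : rnorm b <= 1.
  rewrite rnormZp; last by rewrite invr_ge0 ltW.
  rewrite mulrC ler_pdivrMr// mul1r.
  by rewrite -(@ler_pXn2r _ 2) ?nnegrE ?rnorm_ge0 ?(ltW s0)// st.
have ab : a * a = t%:c *: (b * b).
  have tss : t%:c * (s^-1%:c * s^-1%:c) = 1.
    rewrite -!rmorphM -[RHS](rmorph1 (real_complex R)) -st; congr (_%:c); field.
    by rewrite gt_eqF.
  by rewrite -scalerAl -scalerAr !scalerA -mulrA tss scale1r.
rewrite ab -scalerBr rnormZr ger0_norm// -[leRHS]mulr1 ler_wpM2l//.
exact: rnorm_one_sub_sqr.
Qed.

Lemma cpos_sqr a : star a = a -> cpos (a * a).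
Proof.
move=> aE; split; first by rewrite starMr aE.
by exists (rnorm a ^+ 2); rewrite ?sqr_ge0// rnorm_sub_sqr.
Qed.

Lemma cposr t : 0 <= t -> cpos (t%:c%:A : A).
Proof.
move=> t0; split; first exact: starr.
by exists t => //; rewrite subrr rnorm0.
Qed.

Lemma cpos1 : cpos (1 : A).
Proof. by have := cposr ler01; rewrite rmorph1 scale1r. Qed.

Lemma cposD p q : cpos p -> cpos q -> cpos (p + q).
Proof.
move=> [pE [t t0 pt]] [qE [s s0 qs]]; split; first by rewrite starD pE qE.
exists (t + s); first exact: addr_ge0.
rewrite rmorphD scalerDl opprD addrACA.
by apply: (le_trans (ler_rnormD _ _)); rewrite lerD.
Qed.

Lemma cposZ r p : 0 <= r -> cpos p -> cpos (r%:c *: p).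
Proof.
move=> r0 [pE [t t0 pt]]; split; first by rewrite starZr pE.
exists (r * t); first exact: mulr_ge0.
by rewrite rmorphM -scalerA -scalerBr rnormZr ger0_norm// ler_wpM2l.
Qed.

(** The discs of center [t] and radius [t] all pass through 0 and grow with [t]. *)
Lemma cpos_ball p s t : s <= t -> rnorm (s%:c%:A - p) <= s -> rnorm (t%:c%:A - p) <= t.
Proof.
move=> st ps; have -> : t%:c%:A - p = (t - s)%:c%:A + (s%:c%:A - p).
  by rewrite rmorphB scalerBl addrA subrK.
apply: (le_trans (ler_rnormD _ _)); rewrite rnormr ger0_norm ?subr_ge0//.
lra.
Qed.

Lemma cpos_sqrt p : cpos p ->
  exists q, [/\ cpos q, q * q = p & forall c, c * p = p * c -> c * q = q * c].
Proof.
move=> [pE [t0 t00 pt0]].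
(* A strictly positive radius allows writing [p / t = 1 - y] with [|y| <= 1]. *)
have [t t_gt0 pt] : exists2 t, 0 < t & rnorm (t%:c%:A - p) <= t.
  by exists (t0 + 1); [lra | apply: cpos_ball pt0; lra].
have tV : t^-1%:c * t%:c = 1 by rewrite -rmorphM mulVf ?gt_eqF ?rmorph1.
have tV' : t%:c * t^-1%:c = 1 by rewrite mulrC.
pose y := 1 - t^-1%:c *: p.
have [||q [qE qq q1 qC]] := @sqrt_one_sub R A y.
- by rewrite starB star1 starZr pE.
- have -> : y = t^-1%:c *: (t%:c%:A - p) by rewrite scalerBr scalerA tV scale1r.
  rewrite rnormZp; last by rewrite invr_ge0 ltW.
  by rewrite mulrC ler_pdivrMr// mul1r.
have s0 : 0 <= Num.sqrt t by rewrite sqrtr_ge0.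
have st : (Num.sqrt t)%:c * (Num.sqrt t)%:c = t%:c.
  by rewrite -rmorphM -expr2 sqr_sqrtr// ltW.
exists ((Num.sqrt t)%:c *: q); split.
- apply: cposZ => //; split=> //; exists 1 => //.
  by rewrite rmorph1 scale1r.
- rewrite -scalerAl -scalerAr scalerA st qq /y opprB addrCA subrr addr0.
  by rewrite scalerA tV' scale1r.
- move=> c cp; rewrite -scalerAl -scalerAr qC// /y mulrBr mulrBl mulr1 mul1r.
  by rewrite -scalerAl -scalerAr cp.
Qed.

Lemma cposM p q : cpos p -> cpos q -> p * q = q * p -> cpos (p * q).
Proof.
move=> /cpos_sqrt[x [[xE _] <- xC]] /cpos_sqrt[y [[yE _] <- yC]] xy.
have xyy : x * (y * y) = y * y * x by rewrite xC.
have yx : x * y = y * x by apply: yC.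
have -> : x * x * (y * y) = x * y * (x * y) 
  by rewrite -mulrA [x * (y * y)]mulrA {1}yx -mulrA mulrA.
by apply: cpos_sqr; rewrite starMr xE yE.
Qed.

(** For the commuting roots [x] and [y] of [p] and [q], the element [u = x + i y] satisfies
    [u^* u = p + q] and has real part [x], so [|x| <= |u|]. *)
Lemma rnorm_cposD p q : cpos p -> cpos q -> p * q = q * p ->
  rnorm p <= rnorm (p + q).
Proof.
move=> /cpos_sqrt[x [[xE _] <- xC]] /cpos_sqrt[y [[yE _] <- yC]] xy.
have xyy : x * (y * y) = y * y * x by rewrite xC.
have yx : x * y = y * x by apply: yC.
pose u := x + 'i *: y.
have uE : star u = x - 'i *: y by rewrite starD starZi xE yE.
have -> : x * x + y * y = star u * u.
  have iN1 : 'i * 'i = -1 :> R[i] by rewrite -expr2 sqrCi.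
  rewrite uE /u mulrDl !mulrDr mulNr -!scalerAl -!scalerAr mulNr -scalerAl yx.
  by rewrite scalerN scalerA iN1 scaleN1r opprK addrA addrK.
rewrite rnorm_sqr// rnorm_starM ler_pXn2r ?nnegrE ?rnorm_ge0//.
have -> : x = 2^-1%:c *: (u + star u).
  by rewrite uE /u; ncring A; field.
rewrite rnormZr ger0_norm//.
have := ler_rnormD u (star u); rewrite rnorm_star; lra.
Qed.

Lemma cpos_star p : cpos p -> star p = p.
Proof. by case. Qed.

Lemma cpos_anti p : cpos p -> cpos (- p) -> p = 0.
Proof.
move=> p0 Np0; apply/rnorm0_eq0/eqP; rewrite eq_le rnorm_ge0 andbT.
have := rnorm_cposD p0 Np0; rewrite subrr rnorm0; apply.
by rewrite mulrN mulNr.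
Qed.

(** Turns the existential radius of [cpos] into any radius at least the norm, because [p] is a
    square. *)
Lemma cpos_rnorm p t : cpos p -> rnorm p <= t -> rnorm (t%:c%:A - p) <= t.
Proof.
move=> /cpos_sqrt[q [[qE _] <- _]]; rewrite rnorm_sqr//.
exact: rnorm_sub_sqr.
Qed.

Lemma cpos_sub_rnorm a r : star a = a -> rnorm a <= r -> cpos (r%:c%:A - a).
Proof.
move=> aE ar; split; first by rewrite starB starr aE.
exists r; first exact: le_trans (rnorm_ge0 _) ar.
by rewrite opprB addrCA subrr addr0.
Qed.

Lemma cpos_add_rnorm a r : star a = a -> rnorm a <= r -> cpos (r%:c%:A + a).
Proof.
move=> aE ar; rewrite -[a]opprK; apply: cpos_sub_rnorm; first by rewrite starN aE.
by rewrite rnormN.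
Qed.

(** The commuting product [(r - a) (r + a) = r^2 - a^2] is positive, and adding it to [a^2] can only
    increase the norm, up to [r^2]. *)
Lemma rnorm_le_cpos a r : 0 <= r -> cpos (r%:c%:A - a) -> cpos (r%:c%:A + a) ->
  rnorm a <= r.
Proof.
move=> r0 ra ra'.
have aE : star a = a.
  have := cpos_star ra'; rewrite starD starr; exact: addrI.
have com : (r%:c%:A - a) * (r%:c%:A + a) = (r%:c%:A + a) * (r%:c%:A - a).
  by ncring A; ring.
have := rnorm_cposD (cpos_sqr aE) (cposM ra ra' com).
have -> : a * a + (r%:c%:A - a) * (r%:c%:A + a) = (r ^+ 2)%:c%:A.
  by rewrite rmorphXn; ncring A; ring.
rewrite rnormr rnorm_sqr// ger0_norm ?sqr_ge0// ler_pXn2r ?nnegrE ?rnorm_ge0//.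
by apply; ncring A; ring.
Qed.

Lemma cpos_closed p : (forall e : R, 0 < e -> cpos (p + e%:c%:A)) -> cpos p.
Proof.
move=> pe; split.
  have := cpos_star (pe _ ltr01); rewrite starD starr; exact: addIr.
exists (rnorm p); first exact: rnorm_ge0.
apply/ler_addgt0Pr => e e0.
have -> : (rnorm p)%:c%:A - p = (rnorm p + e)%:c%:A - (p + e%:c%:A).
  by rewrite rmorphD scalerDl opprD addrACA subrr addr0.
apply: cpos_rnorm; first exact: pe.
by apply: (le_trans (ler_rnormD _ _)); rewrite rnormr (ger0_norm (ltW e0)).
Qed.

End PositiveCone.

(** If [b > T], the powers of [b / T] would outgrow the linear factor. This plays the role of the
    spectral radius formula. *)
Lemma le_of_pow2 (R : realType) (b T C : R) : 0 < T -> 0 <= C ->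
  (forall n, b ^+ (2 ^ n) <= T ^+ (2 ^ n) * (1 + (2 ^ n)%:R * C)) -> b <= T.
Proof.
move=> T0 C0 bT; rewrite leNgt; apply/negP => Tb.
pose d := b / T - 1.
have d0 : 0 < d by rewrite subr_gt0 ltr_pdivlMr// mul1r.
have dn n : (1 + d) ^+ (2 ^ n) <= 1 + (2 ^ n)%:R * C.
  rewrite addrC subrK expr_div_n ler_pdivrMr ?exprn_gt0// mulrC.
  exact: bT.
have bernoulli m : 1 + m%:R * d <= (1 + d) ^+ m.
  elim: m => [|m IHm]; first by rewrite mul0r addr0 expr0.
  rewrite exprS -natr1; have m0 : 0 <= m%:R :> R by [].
  move: IHm m0; set k := m%:R; set p := _ ^+ m => kp k0.
  have : 0 <= d * (p - (1 + k * d)) by apply: mulr_ge0; [exact: ltW | rewrite subr_ge0].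
  nra.
have d20 : 0 < d ^+ 2 by rewrite exprn_gt0.
have := archi_boundP (ltW (divr_gt0 (_ : 0 < 1 + 2 * C) d20)).
set n := Num.bound _ => /(_ ltac:(lra)) nd.
have nM : n%:R <= (2 ^ n)%:R :> R by rewrite ler_nat ltnW// ltn_expl.
(* At exponent [2 ^ n.+1] the upper bound is linear in [2 ^ n], whereas the square of Bernoulli's
   bound at [2 ^ n] is quadratic in it. *)
have := dn n.+1; rewrite expnS mulnC exprM natrM => dM.
have M1 : 1 <= (2 ^ n)%:R :> R by rewrite ler1n expn_gt0.
have := bernoulli (2 ^ n)%N.
move: nd; rewrite ltr_pdivrMr// => nd.
move: dM M1 nM nd; set M := (2 ^ n)%:R; set k := n%:R => dM M1 nM nd bM.
have Md0 : 0 <= M * d by rewrite mulr_ge0 ?(ltW d0)//; lra.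
have : (1 + M * d) ^+ 2 <= ((1 + d) ^+ (2 ^ n)) ^+ 2.
  by rewrite ler_pXn2r ?nnegrE//; lra.
have : k * d ^+ 2 <= M * d ^+ 2 by rewrite ler_wpM2r// ltW.
move: dM; set p := _ ^+ 2 => dM kM Mp.
have M2 : 1 + 2 * C < M * d ^+ 2 by lra.
have : 0 <= (M - 1) * (2 * C) by rewrite mulr_ge0//; lra.
have : 0 <= (M - 1) * (M * d ^+ 2 - (1 + 2 * C)) by rewrite mulr_ge0//; lra.
nra.
Qed.

(** * Positivity of [star x * x] *)

Section StarSquares.
Context {R : realType} {A : cstarAlgType R}.
Implicit Types (a b c x y p q : A) (r s t : R).

Lemma star_exp a n : star a = a -> star (a ^+ n) = a ^+ n.
Proof.
move=> aE; elim: n => [|n IHn]; first by rewrite expr0 star1.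
by rewrite exprS starMr IHn aE -exprSr exprS.
Qed.

Lemma rnorm_pow2 a n : star a = a -> rnorm (a ^+ (2 ^ n)) = rnorm a ^+ (2 ^ n).
Proof.
move=> aE; elim: n => [|n IHn]; first by rewrite expn0 !expr1.
by rewrite expnS mulnC !exprM -IHn [a ^+ _ ^+ 2]expr2 rnorm_sqr// star_exp.
Qed.


(* [x^* x] and [x x^*] have the same nonzero spectrum: the powers of
   [t + x x^*] are [t ^ n + x r_n x^*] with [r_n] a combination of powers of
   [t + x^* x], hence with at most linear growth relatively to [t ^ n]. *)
Lemma cposN_starC x : cpos (- (star x * x)) -> cpos (- (x * star x)).
Proof.
move=> xneg; pose t := rnorm x ^+ 2 + 1.
have t0 : 0 < t by rewrite ltr_wpDl ?sqr_ge0.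
have xt : rnorm (t%:c%:A + star x * x) <= t.
  rewrite -[_ * x]opprK; apply: cpos_rnorm => //.
  by rewrite rnormN rnorm_starM lerDl.
split; first by rewrite starN starMr starK.
exists t; rewrite ?(ltW t0)// opprK.
apply: (@le_of_pow2 _ _ t (rnorm x ^+ 2 / t)); rewrite ?divr_ge0 ?sqr_ge0 ?(ltW t0)//.
have expand n : exists2 r, (t%:c%:A + x * star x) ^+ n = (t ^+ n)%:c%:A + x * r * star x
    & rnorm r * t <= n%:R * t ^+ n.
  elim: n => [|n [r rE rn]].
    exists 0; first by rewrite !expr0 rmorph1 scale1r mulr0 mul0r addr0.
    by rewrite rnorm0 !mul0r.
  exists ((t ^+ n)%:c%:A + r * (t%:c%:A + star x * x)).
    rewrite exprSr rE exprSr rmorphM /=; move: (t ^+ n)%:c => u.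
    by ncring A; ring.
  apply: (@le_trans _ _ ((t ^+ n + rnorm r * t) * t)).
    rewrite ler_wpM2r ?(ltW t0)//; apply: (le_trans (ler_rnormD _ _)).
    rewrite rnormr ger0_norm ?exprn_ge0 ?(ltW t0)// lerD2l; apply: (le_trans (rnormM _ _)).
    by rewrite ler_wpM2l ?rnorm_ge0.
  rewrite -natr1 [leRHS]mulrDl mul1r exprSr mulrA -mulrDl ler_wpM2r ?(ltW t0)//.
  by rewrite addrC lerD2r.
move=> n; rewrite -rnorm_pow2; last by rewrite starD starr starMr starK.
have [r -> rn] := expand (2 ^ n)%N.
apply: (le_trans (ler_rnormD _ _)); rewrite rnormr ger0_norm ?exprn_ge0 ?(ltW t0)// mulrDr mulr1 lerD2l.
apply: (le_trans (rnormM _ _)); rewrite rnorm_star.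
apply: (@le_trans _ _ (rnorm r * rnorm x ^+ 2)).
  by rewrite expr2 mulrA ler_wpM2r ?rnorm_ge0// [leRHS]mulrC rnormM.
rewrite -(ler_pM2r t0) mulrAC; move: rn; set k := (2 ^ n)%:R; set u := t ^+ _.
move=> rn; have -> : u * (k * (rnorm x ^+ 2 / t)) * t = k * u * rnorm x ^+ 2.
  by field; rewrite gt_eqF.
by rewrite ler_wpM2r// sqr_ge0.
Qed.

Lemma sa_decomposition x : exists a b,
  [/\ star a = a, star b = b & x = a + 'i *: b].
Proof.
have iN1 : 'i * 'i = -1 :> R[i] by rewrite -expr2 sqrCi.
exists (2^-1%:c *: (x + star x)), (2^-1%:c *: ('i *: (star x - x))); split.
- by rewrite starZr starD starK addrC.
- by rewrite starZr starZi starB starK -scalerN opprB.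
- rewrite !scalerA [_ * 'i]mulrC mulrA iN1.
  by ncring A; field.
Qed.

Lemma star_i_comb a b : star a = a -> star b = b ->
  star (a + 'i *: b) = a - 'i *: b.
Proof. by move=> aE bE; rewrite starD starZi aE bE. Qed.

(** For [x = a + i b] the cross terms cancel. In Kaplansky's argument this bounds [z^* z] below by
    [- z z^*]. *)
Lemma star_squares_sum x : exists a b,
  [/\ star a = a, star b = b &
      star x * x + x * star x = 2%:c *: (a * a + b * b)].
Proof.
have iN1 : 'i * 'i = -1 :> R[i] by rewrite -expr2 sqrCi.
have [a [b [aE bE ->]]] := sa_decomposition x; exists a, b; split=> //.
rewrite star_i_comb//; move: iN1; set i := 'i => iN1.
by ncring A; rewrite ?rmorph_nat; ring: iN1.
Qed.

(* Kaplansky's argument. With [q = |y|] and [d = q - y], twice the negative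
   part of [y = x^* x], the element [z = x d] satisfies
   [z^* z = - d^3 / 2 <= 0], hence [z z^* <= 0], whereas [z^* z + z z^*] is a
   sum of squares. *)
Lemma cpos_starM x : cpos (star x * x).
Proof.
set y := star x * x.
have yE : star y = y by rewrite /y starMr starK.
have [q [q0 qq qC]] := cpos_sqrt (cpos_sqr yE).
have yq : y * q = q * y by apply: qC; rewrite mulrA.
have qE := cpos_star q0.
have [d ddef] : exists d, d = q - y by exists (q - y).
have dE : star d = d by rewrite ddef starB qE yE.
have dq : d * q = q * d by rewrite ddef mulrBr mulrBl yq.
have d2 : d * d = 2%:c *: (q * d).
  rewrite ddef !mulrBl !mulrBr -qq yq.
  by ncring A; rewrite ?rmorph_nat; ring.
have dyd : d * y * d = - (2^-1%:c *: (d * d * d)).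
  have -> : y = q - d by rewrite ddef opprB addrCA subrr addr0.
  rewrite mulrBr mulrBl dq -[q * d * d]mulrA.
  have -> : q * (d * d) = 2^-1%:c *: (d * d * d).
    rewrite {2}d2 -scalerAl scalerA -rmorphM mulVf// rmorph1 scale1r.
    by rewrite mulrA.
  by ncring A; field.
have ddq : d * d * q = q * (d * d) by rewrite -mulrA dq mulrA dq mulrA.
have d3 : cpos (d * d * d).
  rewrite d2 -scalerAl; apply: cposZ => //; rewrite -mulrA.
  by apply: cposM => //; exact: cpos_sqr.
pose z := x * d.
have zz : star z * z = - (2^-1%:c *: (d * d * d)).
  by rewrite -dyd /z starMr dE /y !mulrA.
have zz_neg : cpos (- (star z * z)).
  by rewrite zz opprK; apply: cposZ => //; rewrite invr_ge0.
have zz'_neg := cposN_starC zz_neg.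
have [a [b [aE bE zsum]]] := star_squares_sum z.
have zz_pos : cpos (star z * z).
  have -> : star z * z = 2%:c *: (a * a + b * b) + - (z * star z).
    by rewrite -zsum addrK.
  apply: cposD => //; apply: cposZ => //.
  by apply: cposD; exact: cpos_sqr.
have zz0 : star z * z = 0 by apply: cpos_anti.
have d30 : d * d * d = 0.
  move/eqP: zz0; rewrite zz oppr_eq0 scaler_eq0 => /orP[|/eqP//].
  by rewrite fmorph_eq0 invr_eq0 pnatr_eq0.
have dd0 : d * d = 0.
  apply/rnorm0_eq0/eqP; rewrite -sqrf_eq0 -rnorm_sqr.
    by rewrite mulrA d30 mul0r rnorm0.
  by rewrite starMr dE.
have d0 : d = 0.
  by apply/rnorm0_eq0/eqP; rewrite -sqrf_eq0 -rnorm_sqr// dd0 rnorm0.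
by move/eqP: d0; rewrite ddef subr_eq0 => /eqP <-.
Qed.

Lemma cpos_conj p c : cpos p -> star c = c -> cpos (c * p * c).
Proof.
move=> /cpos_sqrt[q [[qE _] <- _]] cE.
have -> : c * (q * q) * c = star (q * c) * (q * c) by rewrite starMr qE cE !mulrA.
exact: cpos_starM.
Qed.

End StarSquares.

(** * Kadison's inequality *)

Section Linear.
Context {K : pzRingType} {V W : lmodType K} {f : V -> W}.

Lemma linear_fun0 : linear f -> f 0 = 0.
Proof. by move=> fL; rewrite -[0](addNr 0) -scaleN1r fL scaleN1r addNr. Qed.

Lemma linear_funD u v : linear f -> f (u + v) = f u + f v.
Proof. by move=> fL; rewrite -[u]scale1r fL !scale1r. Qed.

Lemma linear_funZ k u : linear f -> f (k *: u) = k *: f u.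
Proof. by move=> fL; rewrite -[k *: u]addr0 fL linear_fun0// addr0. Qed.

Lemma linear_funN u : linear f -> f (- u) = - f u.
Proof. by move=> fL; rewrite -scaleN1r linear_funZ// scaleN1r. Qed.

Lemma linear_funB u v : linear f -> f (u - v) = f u - f v.
Proof. by move=> fL; rewrite linear_funD// linear_funN. Qed.

Lemma linear_funMn u n : linear f -> f (u *+ n) = n%:R *: f u.
Proof. by move=> fL; rewrite -scaler_nat linear_funZ. Qed.

End Linear.

Section Kadison.
Context {R : realType} {A : cstarAlgType R}.
Implicit Types (b c m s : A) (p z : {poly R[i]}).

(* Nonnegativity of the matrix [[s, b], [b, m]] on the vectors [(c, 1)]; it
   holds for the moments [s = sum a_i], [b = sum k_i a_i] and
   [m = sum k_i ^ 2 a_i] of any positive [a_i]. *)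
Let moment_pos s b m := forall c, star c = c -> cpos (c * s * c + c * b + b * c + m).

(* The weights [bin(n, k) z^k (1 - z)^(n - k)] at the points [k] have moments
   [1], [n z] and [(n z)^2 + n z (1 - z)]; the induction peels off one
   Bernoulli step, so the weights themselves never appear. *)
Let bernstein_moments (Phi : {poly R[i]} -> A) (P : {poly R[i]} -> Prop) z :
  linear Phi -> (forall p, P p -> cpos (Phi p)) ->
  (forall p q, P p -> P q -> P (p * q)) -> P z -> P (1 - z) ->
  forall n p (m : nat), P p ->
  moment_pos (Phi p) (Phi (p * (m%:R + n%:R * z)))
    (Phi (p * ((m%:R + n%:R * z) ^+ 2 + n%:R * z * (1 - z)))).
Proof.
move=> PhiL Phi0 PM Pz Pz'; elim=> [|n IHn] p m Pp c cE.
  rewrite !mul0r !addr0 expr2 -natrM !mulr_natr !(linear_funMn _ _ PhiL).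
  rewrite natrM.
  have mE : star (c + m%:R%:c%:A) = c + m%:R%:c%:A by rewrite starD starr cE.
  have := cpos_conj (Phi0 _ Pp) mE; rewrite rmorph_nat.
  move: (Phi p) => a.
  congr (cpos _); move: (m%:R : R[i]) => k; ncring A; ring.
have IH1 := IHn _ m (PM _ _ Pp Pz') c cE.
have IH2 := IHn _ m.+1 (PM _ _ Pp Pz) c cE.
have := cposD IH1 IH2; congr (cpos _).
have -> : Phi p = Phi (p * (1 - z)) + Phi (p * z).
  by rewrite -(linear_funD _ _ PhiL); congr Phi; ring.
have -> : Phi (p * (m%:R + n.+1%:R * z)) =
    Phi (p * (1 - z) * (m%:R + n%:R * z)) + Phi (p * z * (m.+1%:R + n%:R * z)).
  by rewrite -(linear_funD _ _ PhiL); congr Phi; ring.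
have -> : Phi (p * ((m%:R + n.+1%:R * z) ^+ 2 + n.+1%:R * z * (1 - z))) =
    Phi (p * (1 - z) * ((m%:R + n%:R * z) ^+ 2 + n%:R * z * (1 - z))) +
    Phi (p * z * ((m.+1%:R + n%:R * z) ^+ 2 + n%:R * z * (1 - z))).
  by rewrite -(linear_funD _ _ PhiL); congr Phi; ring.
move: (Phi _) (Phi _) (Phi _) (Phi _) (Phi _) (Phi _) => a1 a2 a3 a4 a5 a6.
by ncring A; ring.
Qed.

(** The Bernstein moments of [1], tested at [c = - n Phi(z)], give [n^2 (Phi(z^2) - Phi(z)^2) + n
    Phi(z (1 - z)) >= 0]. Dividing by [n^2] and letting [n] grow removes the last term. *)
Lemma kadison_ineq (Phi : {poly R[i]} -> A) (P : {poly R[i]} -> Prop) z :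
  linear Phi -> Phi 1 = 1 -> (forall p, P p -> cpos (Phi p)) ->
  (forall p q, P p -> P q -> P (p * q)) -> P 1 -> P z -> P (1 - z) ->
  cpos (Phi (z * z) - Phi z * Phi z).
Proof.
move=> PhiL Phi1 Phi0 PM P1 Pz Pz'; apply: cpos_closed => e e0.
have zE : star (Phi z) = Phi z by apply: cpos_star; exact: Phi0.
set v := Phi (z * (1 - z)).
have vE : star v = v by apply: cpos_star; apply: Phi0; exact: PM.
have [n [n0 vn]] : exists n : nat, (0 : R) < n%:R /\ rnorm v <= e * n%:R.
  exists (Num.bound (rnorm v / e)).+1; split; first by rewrite ltr0n.
  have := archi_boundP (divr_ge0 (rnorm_ge0 v) (ltW e0)).
  rewrite ltr_pdivrMr// mulrC => /ltW /le_trans; apply.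
  by rewrite ler_wpM2l ?(ltW e0)// ler_nat.
have nE : star (- (n%:R%:c *: Phi z)) = - (n%:R%:c *: Phi z).
  by rewrite starN starZr zE.
have := bernstein_moments PhiL Phi0 PM Pz Pz' n 0 P1 nE.
rewrite Phi1 !mul1r add0r.
have -> : Phi (n%:R * z) = n%:R%:c *: Phi z.
  by rewrite mulr_natl (linear_funMn _ _ PhiL) rmorph_nat.
have -> : Phi ((n%:R * z) ^+ 2 + n%:R * z * (1 - z)) =
    (n%:R%:c * n%:R%:c) *: Phi (z * z) + n%:R%:c *: v.
  have -> : (n%:R * z) ^+ 2 + n%:R * z * (1 - z) = (z * z) *+ n *+ n + (z * (1 - z)) *+ n.
    by rewrite -(mulr_natr (z * z *+ n)) -(mulr_natr (z * z)) -(mulr_natr (z * (1 - z))); ring.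
  rewrite (linear_funD _ _ PhiL) !(linear_funMn _ _ PhiL) scalerA.
  by rewrite rmorph_nat.
move=> mom; have n2 : 0 <= n%:R^-1 ^+ 2 :> R by rewrite sqr_ge0.
have n1 : 0 <= n%:R^-1 :> R by rewrite invr_ge0 ltW.
(* Adding [e - v / n >= 0] cancels the variance term [v / n] exactly. *)
have := cposD (cposZ n2 mom) (cposZ n1 (cpos_sub_rnorm vE vn)).
have nnV : n%:R%:c * n%:R^-1%:c = 1 :> R[i].
  by rewrite -rmorphM mulfV ?gt_eqF// rmorph1.
rewrite rmorphXn rmorphM.
congr (cpos _).
rewrite -/v; move: (Phi (z * z)) (Phi z) (v) nnV => /= a b w; move: n%:R%:c n%:R^-1%:c e%:c => k l f kl.
by ncring A; ring: kl.
Qed.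

End Kadison.

(** * Self-adjoint Lipschitz maps under unital isometries *)

Section ShiftNorms.
Context {R : realType} {A : cstarAlgType R}.
Implicit Types (a b : A) (s t k : R).

Lemma rnorm_comb_sqr a b : star a = a -> star b = b -> a * b = b * a ->
  rnorm (a + 'i *: b) ^+ 2 <= rnorm a ^+ 2 + rnorm b ^+ 2.
Proof.
move=> aE bE ab; rewrite -rnorm_starM star_i_comb//.
have -> : (a - 'i *: b) * (a + 'i *: b) = a * a + b * b.
  have iN1 : 'i * 'i = -1 :> R[i] by rewrite -expr2 sqrCi.
  rewrite mulrDl !mulrDr mulNr -!scalerAl -!scalerAr mulNr -scalerAl ab.
  by rewrite scalerN scalerA iN1 scaleN1r opprK addrA addrK.
by apply: (le_trans (ler_rnormD _ _)); rewrite !rnorm_sqr.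
Qed.

Lemma rnorm_re_le a b : star a = a -> star b = b -> rnorm a <= rnorm (a + 'i *: b).
Proof.
move=> aE bE; have := ler_rnormD (a + 'i *: b) (star (a + 'i *: b)).
rewrite rnorm_star star_i_comb// addrACA subrr addr0.
have -> : a + a = 2%:c *: a by rewrite rmorph_nat scaler_nat.
by rewrite rnormZp//; lra.
Qed.

Lemma rnorm_im_le a b : star a = a -> star b = b -> rnorm b <= rnorm (a + 'i *: b).
Proof.
move=> aE bE; rewrite -[leRHS]rnormN -[leRHS]rnormZi.
have -> : 'i *: - (a + 'i *: b) = b + 'i *: (- a).
  by rewrite !scalerN scalerDr scalerA -expr2 sqrCi scaleN1r opprD opprK addrC.
by apply: rnorm_re_le => //; rewrite starN aE.
Qed.

(** The bounds at [t = s] and [t = - s] say that [k - a] and [k + a] lie in discs of center and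
    radius [k + s], hence are positive. *)
Lemma rnorm_shift_le a s k : star a = a -> 0 <= s ->
  (forall t, `|t| = s -> rnorm (a + t%:c%:A) <= s + k) -> rnorm a <= k.
Proof.
move=> aE s0 ak; have ap := ak s (ger0_norm s0).
have an : rnorm (a + (- s)%:c%:A) <= s + k by apply: ak; rewrite normrN ger0_norm.
have k0 : 0 <= k.
  have := ler_rnormD (a + s%:c%:A) (- (a + (- s)%:c%:A)); rewrite rnormN.
  have -> : a + s%:c%:A - (a + (- s)%:c%:A) = (2 * s)%:c%:A.
    by rewrite rmorphM rmorphN rmorph_nat /=; ncring A; ring.
  by rewrite rnormr ger0_norm ?mulr_ge0//; lra.
have ks0 : 0 <= k + s by rewrite addr_ge0.
apply: rnorm_le_cpos => //.
  split; first by rewrite starB starr aE.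
  exists (k + s) => //; rewrite rmorphD /=.
  have -> : (k%:c + s%:c)%:A - (k%:c%:A - a) = a + s%:c%:A by ncring A; ring.
  by rewrite [k + s]addrC.
split; first by rewrite starD starr aE.
exists (k + s) => //; rewrite -rnormN rmorphD /=.
have -> : - ((k%:c + s%:c)%:A - (k%:c%:A + a)) = a + (- s)%:c%:A.
  by rewrite rmorphN /=; ncring A; ring.
by rewrite [k + s]addrC.
Qed.

End ShiftNorms.

(** The hypotenuse with legs [f] and [s] exceeds [s] by less and less as [s] grows; the witness
    makes [2 s e = f^2]. *)
Lemma large_hypot (R : realType) (f e : R) : 0 < e ->
  exists2 s : R, 0 <= s & f ^+ 2 + s ^+ 2 <= (s + e) ^+ 2.
Proof.
move=> e0; exists (f ^+ 2 / (2 * e)); first by rewrite divr_ge0 ?sqr_ge0//; lra.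
set s := _ / _; have -> : f ^+ 2 = s * (2 * e).
  by rewrite /s divfK// mulf_neq0// gt_eqF.
have := sqr_ge0 e; nra.
Qed.

(** * Pointwise operations on Lipschitz maps *)

Section LipAlgebra.
Context {R : realType} {X : compactMetricType R} {A : cstarAlgType R}.
Implicit Types (F G H : Lip X A).

Definition lip_sa F : Prop := forall x, star (F x) = F x.

Definition lip_pos F : Prop := forall x, cpos (F x).

Lemma lip_eqP F G : (forall x, F x = G x) -> F = G.
Proof. by move=> FG; apply/val_inj/funext. Qed.

Lemma is_lip_star F : (fun x => star (F x)) \in is_lip.
Proof.
apply/is_lipP; have [k k0 kF] := is_lipP _ (lip_funP F).
by exists k => // x y; rewrite -starB rnorm_star.
Qed.
Definition lip_star F : Lip X A := Build_Lip (is_lip_star F).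

Lemma is_lip_mul F G : (fun x => F x * G x) \in is_lip.
Proof.
apply/is_lipP; have f0 := sup_norm_ge0 F; have g0 := sup_norm_ge0 G.
have lf := lip_const_ge0 F; have lg := lip_const_ge0 G.
exists (sup_norm F * lip_const G + lip_const F * sup_norm G).
  by rewrite addr_ge0 ?mulr_ge0.
move=> x y; have -> : F x * G x - F y * G y = F x * (G x - G y) + (F x - F y) * G y.
  by rewrite mulrBr mulrBl addrA subrK.
apply: (le_trans (ler_rnormD _ _)); rewrite [leRHS]mulrDl lerD//.
  apply: (le_trans (rnormM _ _)); rewrite -mulrA.
  by apply: ler_pM; rewrite ?rnorm_ge0 ?sup_norm_ub ?lip_const_ub.
apply: (le_trans (rnormM _ _)); rewrite mulrAC.
by apply: ler_pM; rewrite ?rnorm_ge0 ?sup_norm_ub ?lip_const_ub.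
Qed.
Definition lip_mul F G : Lip X A := Build_Lip (is_lip_mul F G).

Lemma lip_addE F G x : (F + G) x = F x + G x. Proof. by []. Qed.
Lemma lip_oppE F x : (- F) x = - F x. Proof. by []. Qed.
Lemma lip_scaleE (c : R[i]) F x : (c *: F) x = c *: F x. Proof. by []. Qed.
Lemma lip_zeroE x : (0 : Lip X A) x = 0. Proof. by []. Qed.
Lemma lip_cstE (a : A) (x : X) : lip_cst a x = a. Proof. by []. Qed.
Definition lip_scalar (c : R[i]) : Lip X A := lip_cst (c%:A : A).
Lemma lip_scalarE (c : R[i]) x : lip_scalar c x = c%:A. Proof. by []. Qed.
Lemma lip_starE F x : lip_star F x = star (F x). Proof. by []. Qed.
Lemma lip_mulE F G x : lip_mul F G x = F x * G x. Proof. by []. Qed.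
Definition lipE := (lip_addE, lip_oppE, lip_scaleE, lip_zeroE, 
  lip_cstE, lip_scalarE, lip_starE, lip_mulE).

Lemma lip_sa_decomposition F : exists G H, [/\ lip_sa G, lip_sa H & F = G + 'i *: H].
Proof.
have iN1 : 'i * 'i = -1 :> R[i] by rewrite -expr2 sqrCi.
exists (2^-1%:c *: (F + lip_star F)), (2^-1%:c *: ('i *: (lip_star F - F))); split.
- by move=> x; rewrite !lipE starZr starD starK addrC.
- by move=> x; rewrite !lipE starZr starZi starB starK -scalerN opprB.
- apply: lip_eqP => x; rewrite !lipE !scalerA [_ * 'i]mulrC mulrA iN1.
  by ncring A; field.
Qed.

Lemma lip_const_shift F (a : A) : lip_const (F + lip_cst a) = lip_const F.
Proof.
rewrite /lip_const /lip_quotients; congr (sup (image _ _)); apply/funext => -[x y] /=.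
by congr (rnorm _ / _); rewrite opprD addrACA subrr addr0.
Qed.

End LipAlgebra.

Definition unital_isometry (R : realType) (X1 X2 : compactMetricType R)
    (A1 A2 : cstarAlgType R) (U : Lip X1 A1 -> Lip X2 A2) : Prop :=
  [/\ linear U, forall F, lip_norm (U F) = lip_norm F &
      U (lip_cst (1 : A1)) = lip_cst (1 : A2)].

Section UnitalIsometry.
Context {R : realType} {X1 X2 : compactMetricType R} {A1 A2 : cstarAlgType R}.
Context {U : Lip X1 A1 -> Lip X2 A2}.
Hypothesis Uiso : unital_isometry U.
Implicit Types (F : Lip X1 A1) (G H : Lip X2 A2).

Lemma unital_isometry_scalar (c : R[i]) : U (lip_scalar c) = lip_scalar c.
Proof.
have [UL _ U1] := Uiso.
have -> : lip_scalar c = c *: lip_cst (1 : A1) :> Lip X1 A1 by apply: lip_eqP.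
by rewrite linear_funZ// U1; apply: lip_eqP.
Qed.

(** Scalar shifts leave both Lipschitz constants unchanged, so the two sup norms differ by the same
    amount for every [c]. *)
Lemma sup_norm_shift F (c : R[i]) :
  sup_norm (F + lip_scalar c) + lip_const F =
  sup_norm (U F + lip_scalar c) + lip_const (U F).
Proof.
have [UL Unorm _] := Uiso; have := Unorm (F + lip_scalar c).
by rewrite linear_funD// unital_isometry_scalar /lip_norm !lip_const_shift.
Qed.

Section RealImaginaryParts.
Context {F : Lip X1 A1} {G H : Lip X2 A2}.
Hypotheses (Fsa : lip_sa F) (Gsa : lip_sa G) (Hsa : lip_sa H).
Hypothesis UF : U F = G + 'i *: H.

(** Shift by [i t] with [|t| = s] large: the sup norm of the shifted [F] is at most [s + e] because
    [F] is self-adjoint, while the shifted [U F] dominates [H + t]. *)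
Lemma sup_norm_im_le : sup_norm H <= lip_const F - lip_const (U F).
Proof.
apply: sup_norm_le => y; apply/ler_addgt0Pr => e e0.
have [s s0 sP] := large_hypot (sup_norm F) e0.
apply: (@rnorm_shift_le _ _ _ s) => // t ts.
have bE : star (H y + t%:c%:A) = H y + t%:c%:A by rewrite starD Hsa starr.
apply: (le_trans (rnorm_im_le (Gsa y) bE)).
have -> : G y + 'i *: (H y + t%:c%:A) = (U F + lip_scalar ('i * t%:c)) y.
  by rewrite UF !lipE scalerDr addrA scalerA.
apply: (le_trans (sup_norm_ub _ _)); have := sup_norm_shift F ('i * t%:c).
suff : sup_norm (F + lip_scalar ('i * t%:c)) <= s + e by lra.
apply: sup_norm_le => x; rewrite !lipE -scalerA.
rewrite -(@ler_pXn2r _ 2) ?nnegrE ?rnorm_ge0//; last lra.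
apply: (le_trans (rnorm_comb_sqr (Fsa x) (starr _) _)).
  by rewrite -scalerAl -scalerAr mulr1 mul1r.
apply: le_trans sP; rewrite rnormr ts lerD2r ler_pXn2r ?nnegrE ?rnorm_ge0 ?sup_norm_ge0//.
exact: sup_norm_ub.
Qed.

Lemma sup_norm_re_ge : sup_norm F + (lip_const F - lip_const (U F)) <= sup_norm G.
Proof.
rewrite -lerBrDr; apply: sup_norm_le => x; apply/ler_addgt0Pr => e e0.
have [s s0 sP] := large_hypot (sup_norm H) e0.
apply: (@rnorm_shift_le _ _ _ (2 * s)) => //; first by rewrite mulr_ge0.
move=> t ts; have := sup_norm_ub (F + lip_scalar t%:c) x; rewrite !lipE => /le_trans; apply.
have := sup_norm_shift F t%:c.
suff : sup_norm (U F + lip_scalar t%:c) <= 2 * s + sup_norm G + e by lra.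
apply: sup_norm_le => y; rewrite UF !lipE.
(* One half of the real shift goes to [G], by the triangle inequality; the other half absorbs [i H]
   at cost [e]. *)
pose u := t / 2; have us : `|u| = s by rewrite /u normrM ts ger0_norm//; field.
have -> : G y + 'i *: H y + t%:c%:A = (G y + u%:c%:A) + (u%:c%:A + 'i *: H y).
  have -> : t = u + u by rewrite /u; field.
  by rewrite rmorphD /=; ncring A2; ring.
apply: (le_trans (ler_rnormD _ _)).
have gs : rnorm (G y + u%:c%:A) <= sup_norm G + s.
  by apply: (le_trans (ler_rnormD _ _)); rewrite rnormr us lerD2r sup_norm_ub.
suff : rnorm (u%:c%:A + 'i *: H y) <= s + e by lra.
rewrite -(@ler_pXn2r _ 2) ?nnegrE ?rnorm_ge0//; last lra.
apply: (le_trans (rnorm_comb_sqr (starr _) (Hsa y) _)).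
  by rewrite -scalerAl -scalerAr mulr1 mul1r.
apply: le_trans sP; rewrite rnormr us addrC lerD2r ler_pXn2r ?nnegrE ?rnorm_ge0 ?sup_norm_ge0//.
exact: sup_norm_ub.
Qed.

End RealImaginaryParts.
End UnitalIsometry.

Lemma i_comb_inj (R : realType) (A : cstarAlgType R) (a b c d : A) :
  star a = a -> star b = b -> star c = c -> star d = d ->
  a + 'i *: b = c + 'i *: d -> a = c /\ b = d.
Proof.
move=> aE bE cE dE abcd.
have acE : star (a - c) = a - c by rewrite starB aE cE.
have bdE : star (b - d) = b - d by rewrite starB bE dE.
have z0 : (a - c) + 'i *: (b - d) = 0.
  by rewrite scalerBr addrACA -opprD abcd subrr.
have := rnorm_re_le acE bdE; have := rnorm_im_le acE bdE; rewrite z0 rnorm0.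
by split; apply/eqP; rewrite -subr_eq0; apply/eqP/rnorm0_eq0/eqP;
  rewrite eq_le rnorm_ge0 andbT.
Qed.

Section InverseIsometries.
Context {R : realType} {X1 X2 : compactMetricType R} {A1 A2 : cstarAlgType R}.
Context {U : Lip X1 A1 -> Lip X2 A2} {V : Lip X2 A2 -> Lip X1 A1}.
Hypotheses (Uiso : unital_isometry U) (Viso : unital_isometry V) (UK : cancel U V).
Implicit Types (F : Lip X1 A1) (G H : Lip X2 A2).

(** Let [r], [r'], [r''] be the losses of Lipschitz constant of [F] under [U] and of [G], [H] under
    [V]. Comparing the parts of [F = V G + i V H], the inequalities chain to [r + r' <= r''] and
    [|H| + r'' <= r']. Hence [r + |H| <= 0], and [|H| <= r] forces both to vanish. *)
Lemma unital_isometry_sa F : lip_sa F -> lip_sa (U F) /\ lip_const (U F) = lip_const F.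
Proof.
move=> Fsa; have [VL _ _] := Viso.
have [G [H [Gsa Hsa UF]]] := lip_sa_decomposition (U F).
have [G1 [H1 [G1sa H1sa VG]]] := lip_sa_decomposition (V G).
have [G2 [H2 [G2sa H2sa VH]]] := lip_sa_decomposition (V H).
have parts x : F x = G1 x - H2 x /\ 0 = H1 x + G2 x.
  apply: i_comb_inj; rewrite ?starB ?starD ?G1sa ?H2sa ?H1sa ?G2sa ?star0//.
  rewrite scaler0 addr0 -[in LHS](UK F) UF linear_funD// linear_funZ// VG VH !lipE.
  have iN1 : 'i * 'i = -1 :> R[i] by rewrite -expr2 sqrCi.
  by ncring A1; ring: iN1.
have a1 := sup_norm_im_le Uiso Fsa Gsa Hsa UF.
have b1 := sup_norm_re_ge Uiso Fsa Hsa UF.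
have a2 := sup_norm_im_le Viso Gsa G1sa H1sa VG.
have b2 := sup_norm_re_ge Viso Gsa H1sa VG.
have a3 := sup_norm_im_le Viso Hsa G2sa H2sa VH.
have b3 := sup_norm_re_ge Viso Hsa H2sa VH.
have g1 : sup_norm G1 <= sup_norm F + sup_norm H2.
  apply: sup_norm_le => x; have [Fx _] := parts x.
  have -> : G1 x = F x + H2 x by rewrite Fx subrK.
  by apply: (le_trans (ler_rnormD _ _)); rewrite lerD ?sup_norm_ub.
have g2 : sup_norm G2 <= sup_norm H1.
  apply: sup_norm_le => x; have [_ /esym/eqP] := parts x.
  by rewrite addr_eq0 => /eqP H1x; rewrite -rnormN -H1x sup_norm_ub.
have h0 := sup_norm_ge0 H.
have H0 y : H y = 0.
  by apply/rnorm0_eq0/eqP; rewrite eq_le rnorm_ge0 andbT (le_trans (sup_norm_ub H y))//; lra.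
split; last lra.
by move=> y; rewrite UF !lipE H0 scaler0 addr0 Gsa.
Qed.

(** The radius [sup_norm F] serves at every point, so positivity bounds the sup norm of
    [F - sup_norm F], which [U] preserves once the Lipschitz constants agree. *)
Lemma unital_isometry_pos F : lip_pos F -> lip_pos (U F).
Proof.
move=> F0; have Fsa : lip_sa F by move=> x; exact: cpos_star.
have [UFsa UFL] := unital_isometry_sa Fsa.
move=> y; split; first exact: UFsa.
exists (sup_norm F); first exact: sup_norm_ge0.
have := sup_norm_shift Uiso F (- sup_norm F)%:c; rewrite UFL => /addIr shift.
rewrite -rnormN opprB.
have -> : U F y - (sup_norm F)%:c%:A = (U F + lip_scalar (- sup_norm F)%:c) y.
  by rewrite !lipE rmorphN scaleNr.
apply: (le_trans (sup_norm_ub _ _)); rewrite -shift; apply: sup_norm_le => x.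
rewrite !lipE rmorphN scaleNr -rnormN opprB.
by apply: cpos_rnorm => //; exact: sup_norm_ub.
Qed.

End InverseIsometries.

(** * Unital isometries are Jordan maps *)

Lemma horner_algZ (K : comNzRingType) (A : algType K) (a : A) (c : K) (p : {poly K}) :
  horner_alg a (c *: p) = c *: horner_alg a p.
Proof. by rewrite linearZ /= mulr_algl. Qed.

Section LipPolynomials.
Context {R : realType} {X : compactMetricType R} {A : cstarAlgType R}.
Implicit Types (F : Lip X A) (p : {poly R[i]}).

Lemma is_lip_horner F p : (fun x => horner_alg (F x) p) \in is_lip.
Proof.
elim/poly_ind: p => [|p c IHp].
  have -> : (fun x => horner_alg (F x) 0) = (0 : Lip X A) :> (X -> A).
    by apply/funext => x; rewrite raddf0.
  exact: lip_funP.
pose G := Build_Lip IHp.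
have -> : (fun x => horner_alg (F x) (p * 'X + c%:P)) =
    (lip_mul G F + lip_scalar c : Lip X A) :> (X -> A).
  apply/funext => x; rewrite rmorphD rmorphM /= horner_algX horner_algC.
  by [].
exact: lip_funP.
Qed.
Definition lip_horner F p : Lip X A := Build_Lip (is_lip_horner F p).

Lemma lip_hornerE F p x : lip_horner F p x = horner_alg (F x) p.
Proof. by []. Qed.

End LipPolynomials.

Section JordanIsometry.
Context {R : realType} {X1 X2 : compactMetricType R} {A1 A2 : cstarAlgType R}.
Context {U : Lip X1 A1 -> Lip X2 A2} {V : Lip X2 A2 -> Lip X1 A1}.
Hypotheses (Uiso : unital_isometry U) (Viso : unital_isometry V) (UK : cancel U V).
Implicit Types (F : Lip X1 A1) (G H : Lip X2 A2).

(** Kadison's inequality applies to [p |-> U (p(F)) y] and [z = (X + t) / (2 t)], for which [z] and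
    [1 - z] are both positive at [F]. The affine change only multiplies the variance by
    [(2 t)^-2]. *)
Lemma unital_isometry_kadison F y : lip_sa F ->
  cpos (U (lip_mul F F) y - U F y * U F y).
Proof.
move=> Fsa; have [UL _ U1] := Uiso.
pose t := sup_norm F + 1; have t0 : 0 < t by rewrite ltr_wpDl ?sup_norm_ge0.
have Ft x : rnorm (F x) <= t by rewrite (le_trans (sup_norm_ub F x))// lerDl.
pose s := (2 * t)^-1; have s0 : 0 <= s by rewrite invr_ge0 mulr_ge0// ltW.
have st : s%:c * (2 * t%:c) = 1 :> R[i].
  have -> : 2 * t%:c = (2 * t)%:c :> R[i] by rewrite rmorphM rmorph_nat.
  by rewrite -rmorphM mulVf ?rmorph1// mulf_neq0// gt_eqF.
pose z : {poly R[i]} := s%:c *: ('X + t%:c%:P).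
pose Phi p := U (lip_horner F p) y.
pose P (p : {poly R[i]}) := forall x, cpos (horner_alg (F x) p).
have PhiL : linear Phi.
  move=> c p q; rewrite /Phi.
  have -> : lip_horner F (c *: p + q) = c *: lip_horner F p + lip_horner F q.
    by apply: lip_eqP => x; rewrite !lipE !lip_hornerE rmorphD /= horner_algZ.
  by rewrite UL.
have Phi1 : Phi 1 = 1.
  rewrite /Phi; have -> : lip_horner F 1 = lip_cst (1 : A1).
    by apply: lip_eqP => x; rewrite lip_hornerE rmorph1.
  by rewrite U1.
have Phi0 p : P p -> cpos (Phi p) by move=> Pp; apply: (unital_isometry_pos Uiso Viso UK).
have PM p q : P p -> P q -> P (p * q).
  move=> Pp Pq x; rewrite rmorphM /=; apply: cposM => //.
  by rewrite -[LHS](rmorphM (horner_alg (F x))) mulrC rmorphM.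
have P1 : P 1 by move=> x; rewrite rmorph1; exact: cpos1.
have Pz : P z.
  move=> x; rewrite horner_algZ rmorphD /= horner_algX horner_algC.
  by apply: cposZ => //; rewrite addrC; apply: cpos_add_rnorm.
have Pz' : P (1 - z).
  have -> : 1 - z = s%:c *: (t%:c%:P - 'X).
    have -> : 1 = (s%:c * (2 * t%:c))%:P :> {poly R[i]}.
      by rewrite st.
    by rewrite /z -!mul_polyC !polyCM; ring.
  move=> x; rewrite horner_algZ rmorphB /= horner_algX horner_algC.
  by apply: cposZ => //; apply: cpos_sub_rnorm.
have PhiX : Phi 'X = U F y.
  by rewrite /Phi; congr (U _ y); apply: lip_eqP => x; rewrite lip_hornerE horner_algX.
have PhiXX : Phi ('X * 'X) = U (lip_mul F F) y.
  rewrite /Phi; congr (U _ y); apply: lip_eqP => x.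
  by rewrite lip_hornerE rmorphM /= !horner_algX.
have Phiz : Phi z = s%:c *: (U F y + t%:c%:A).
  rewrite (linear_funZ _ _ PhiL) (linear_funD _ _ PhiL) PhiX -[t%:c%:P]mulr1 mul_polyC.
  by rewrite (linear_funZ _ _ PhiL) Phi1.
have Phizz : Phi (z * z) =
    (s%:c * s%:c) *: (U (lip_mul F F) y + (2 * t%:c) *: U F y + (t%:c * t%:c)%:A).
  have -> : z * z = (s%:c * s%:c) *: ('X * 'X + (2 * t%:c) *: 'X + (t%:c * t%:c)%:A).
    by rewrite /z -!mul_polyC !polyCM; ring.
  rewrite (linear_funZ _ _ PhiL) !(linear_funD _ _ PhiL) !(linear_funZ _ _ PhiL).
  by rewrite PhiX PhiXX Phi1.
have := kadison_ineq PhiL Phi1 Phi0 PM P1 Pz Pz'.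
rewrite Phiz Phizz => /(cposZ (sqr_ge0 (2 * t))); congr (cpos _).
rewrite rmorphXn rmorphM rmorph_nat /=.
have t_neq0 : t%:c != 0 by rewrite fmorph_eq0 gt_eqF.
have -> : s%:c = (2 * t%:c)^-1 by rewrite fmorphV rmorphM rmorph_nat.
move: (U F y) (U _ y) (t%:c) t_neq0 => a b k k0.
by ncring A2; field.
Qed.

End JordanIsometry.

Section JordanIsometryPair.
Context {R : realType} {X1 X2 : compactMetricType R} {A1 A2 : cstarAlgType R}.
Context {U : Lip X1 A1 -> Lip X2 A2} {V : Lip X2 A2 -> Lip X1 A1}.
Hypotheses (Uiso : unital_isometry U) (Viso : unital_isometry V).
Hypotheses (UK : cancel U V) (VK : cancel V U).
Implicit Types (F : Lip X1 A1) (G H : Lip X2 A2).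

(** The defect [D] is positive by Kadison for [U], so [V D >= 0]; Kadison for [V] at [U F] gives
    [V D <= 0]. *)
Lemma unital_isometry_sqr F y : lip_sa F -> U (lip_mul F F) y = U F y * U F y.
Proof.
move=> Fsa; have [UL _ _] := Uiso; have [VL _ _] := Viso.
have [UFsa _] := unital_isometry_sa Uiso Viso UK Fsa.
pose D := U (lip_mul F F) - lip_mul (U F) (U F).
have D0 : lip_pos D by move=> y'; exact: (unital_isometry_kadison Uiso Viso UK y' Fsa).
suff D_eq0 : D = 0.
  apply/eqP; rewrite -subr_eq0; apply/eqP.
  by move: D_eq0 => /(congr1 (fun G : Lip X2 A2 => G y)).
rewrite -[D]VK; have -> : V D = 0; last by rewrite linear_fun0.
apply: lip_eqP => x; apply: cpos_anti.
  exact: (unital_isometry_pos Viso Uiso VK).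
have := unital_isometry_kadison Viso Uiso VK x UFsa.
by rewrite /D linear_funB// !UK !lipE opprB.
Qed.

Lemma unital_isometry_jordan F F' y : lip_sa F -> lip_sa F' ->
  U (lip_mul F F' + lip_mul F' F) y = U F y * U F' y + U F' y * U F y.
Proof.
move=> Fsa F'sa; have [UL _ _] := Uiso.
have FF'sa : lip_sa (F + F') by move=> x; rewrite !lipE starD Fsa F'sa.
have := unital_isometry_sqr y FF'sa.
have -> : lip_mul (F + F') (F + F') =
    lip_mul F F + (lip_mul F F' + lip_mul F' F) + lip_mul F' F'.
  by apply: lip_eqP => x; rewrite !lipE; ncring A1; ring.
rewrite !(linear_funD _ _ UL). rewrite !lipE !unital_isometry_sqr//.
move: (U (lip_mul F F') y) (U (lip_mul F' F) y) (U F y) (U F' y) => c d a b E.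
have -> : c + d = (a * a + (c + d) + b * b) - a * a - b * b by ncring A2; ring.
by rewrite E; ncring A2; ring.
Qed.

(** Lipschitz constants are known to be preserved on self-adjoint maps, so [a] is split into its two
    parts first. *)
Lemma unital_isometry_cst a y y' : U (lip_cst a) y = U (lip_cst a) y'.
Proof.
have [UL _ _] := Uiso; have [b [c [bE cE ->]]] := sa_decomposition a.
have sa_cst d : star d = d -> U (lip_cst d) y = U (lip_cst d) y'.
  move=> dE; have dsa : lip_sa (lip_cst d : Lip X1 A1) by [].
  have [_ UL0] := unital_isometry_sa Uiso Viso UK dsa.
  apply/eqP; rewrite -subr_eq0; apply/eqP/rnorm0_eq0/eqP.
  rewrite eq_le rnorm_ge0 andbT; apply: (le_trans (lip_const_ub _ _ _)).
  have : lip_const (lip_cst d : Lip X1 A1) <= 0.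
    by apply: lip_const_le => // x x'; rewrite !lipE subrr rnorm0 mul0r.
  by rewrite -UL0 => L0; rewrite mulr_le0_ge0// mdist_ge0.
have -> : lip_cst (b + 'i *: c) = lip_cst b + 'i *: lip_cst c :> Lip X1 A1.
  exact: lip_eqP.
by rewrite linear_funD// linear_funZ// !lipE !sa_cst.
Qed.

End JordanIsometryPair.

Definition lip_real (R : realType) (X : compactMetricType R) (A : cstarAlgType R)
    (F : Lip X A) (f : X -> R) : Prop :=
  forall x, F x = (f x)%:c%:A.

(** * Images of scalar-valued maps *)

Section CentralMaps.
Context {R : realType} {X1 X2 : compactMetricType R} {A1 A2 : cstarAlgType R}.
Context {U : Lip X1 A1 -> Lip X2 A2} {V : Lip X2 A2 -> Lip X1 A1}.
Hypotheses (Uiso : unital_isometry U) (Viso : unital_isometry V).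
Hypotheses (UK : cancel U V) (VK : cancel V U).
Implicit Types (F : Lip X1 A1) (G H : Lip X2 A2).

(* Centrality of [F] kills its Jordan associators, which [U] preserves; and
   the Jordan associator of [a], [w] and [b] is the commutator [[a, [w, b]]]. *)
Let commutator_central F (f : X1 -> R) y (a b : A2) : lip_real F f ->
  star a = a -> star b = b ->
  a * (U F y * b - b * U F y) = (U F y * b - b * U F y) * a.
Proof.
move=> Ff aE bE; have [UL _ _] := Uiso.
have Fsa : lip_sa F by move=> x; rewrite Ff starr.
have [asa _] := unital_isometry_sa Viso Uiso VK ((fun=> aE) : lip_sa (lip_cst a : Lip X2 A2)).
have [bsa _] := unital_isometry_sa Viso Uiso VK ((fun=> bE) : lip_sa (lip_cst b : Lip X2 A2)).
have Ua : U (V (lip_cst a)) y = a by rewrite VK.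
have Ub : U (V (lip_cst b)) y = b by rewrite VK.
move: (V (lip_cst a)) (V (lip_cst b)) asa bsa Ua Ub => Fa Fb asa bsa Ua Ub.
pose J F F' : Lip X1 A1 := lip_mul F F' + lip_mul F' F.
have Jsa F1 F2 : lip_sa F1 -> lip_sa F2 -> lip_sa (J F1 F2).
  by move=> sa1 sa2 x; rewrite !lipE starD !starMr sa1 sa2 addrC.
have UJ F1 F2 : lip_sa F1 -> lip_sa F2 ->
    U (J F1 F2) y = U F1 y * U F2 y + U F2 y * U F1 y.
  exact: (unital_isometry_jordan Uiso Viso UK VK).
have assoc : J (J F Fa) Fb = J F (J Fa Fb).
  by apply: lip_eqP => x; rewrite !lipE Ff; ncring A1; ring.
have := congr1 (fun F' => U F' y) assoc.
rewrite /= !UJ ?Ua ?Ub//; try exact: Jsa.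
move: (U F y) => w E.
apply/eqP; rewrite -subr_eq0; apply/eqP.
transitivity ((w * a + a * w) * b + b * (w * a + a * w)
   - (w * (a * b + b * a) + (a * b + b * a) * w)).
  by ncring A2; ring.
by rewrite E subrr.
Qed.

Hypothesis A2_factor : is_factor A2.

Lemma central_scalar (c : A2) : star c = c ->
  (forall a, star a = a -> a * c = c * a) -> exists r : R, c = r%:c%:A.
Proof.
move=> cE comm.
have : cstar_center A2 c.
  move=> a; have [a1 [a2 [a1E a2E ->]]] := sa_decomposition a.
  by rewrite mulrDr mulrDl -scalerAr -scalerAl !comm.
rewrite A2_factor => -[k _ kc]; exists (complex.Re k).
have kR : k^* = k.
  apply/eqP; rewrite -subr_eq0; apply/eqP.
  have : (k^* - k)%:A = 0 :> A2.
    have kc' : k^* *: 1 = c by rewrite -cE -kc starZ star1.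
    by rewrite scalerBl kc kc' subrr.
  by move/eqP; rewrite scaler_eq0 oner_eq0 orbF => /eqP.
by rewrite -kc RRe_real// CrealE kR.
Qed.

(** The commutator [d = [w, b]] commutes with [w] and [b], and [[w, b^2] = 2 b d] commutes with [w];
    hence [d^2 = [w, b] d = 0]. As [d^* = - d], the C*-identity gives [d = 0]. *)
Lemma unital_isometry_real F (f : X1 -> R) y : lip_real F f ->
  exists r : R, U F y = r%:c%:A.
Proof.
move=> Ff; have Fsa : lip_sa F by move=> x; rewrite Ff starr.
have [UFsa _] := unital_isometry_sa Uiso Viso UK Fsa.
apply: central_scalar => // b bE.
have comm a c := @commutator_central F f y a c Ff.
have wE := UFsa y.
move: (U F y) wE comm => w wE comm.
have bbE : star (b * b) = b * b by rewrite starMr bE.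
pose d := w * b - b * w.
have bd : b * d = d * b by apply: comm.
have dE : star d = - d by rewrite /d starB !starMr wE bE opprB.
have wd : w * d = d * w by apply: comm.
have dbE : w * (b * b) - b * b * w = 2%:c *: (b * d).
  have -> : 2%:c *: (b * d) = b * d + d * b by rewrite -bd rmorph_nat scaler_nat.
  by rewrite /d; ncring A2; ring.
have wbd : w * (b * d) = b * d * w.
  have := comm _ _ wE bbE; rewrite dbE -scalerAr -scalerAl.
  by apply: scalerI; rewrite fmorph_eq0.
have dd : star d * d = 0.
  rewrite dE mulNr; apply/eqP; rewrite oppr_eq0; apply/eqP.
  rewrite {1}/d mulrBl -[w * b * d]mulrA wbd -[b * w * d]mulrA wd mulrA.
  by rewrite subrr.
have /eqP : rnorm d ^+ 2 = 0 by rewrite -rnorm_starM dd rnorm0.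
by rewrite sqrf_eq0 => /eqP/rnorm0_eq0/eqP; rewrite /d subr_eq0 => /eqP.
Qed.

End CentralMaps.

(** * Representation by a point map *)

Section DistanceMap.
Context {R : realType} {X : compactMetricType R} {A : cstarAlgType R}.

Lemma rnorm_dist (p x y : X) :
  rnorm ((mdist p x)%:c%:A - (mdist p y)%:c%:A : A) <= 1 * mdist x y.
Proof.
rewrite mul1r -scalerBl -rmorphB rnormr.
have := metric_triangle p x y; have := metric_triangle p y x.
by rewrite (metric_sym y x) => h1 h2; rewrite ler_norml; apply/andP; split; lra.
Qed.

Lemma is_lip_dist (p : X) : (fun x => (mdist p x)%:c%:A : A) \in is_lip.
Proof. by apply/is_lipP; exists 1 => //; exact: rnorm_dist. Qed.
Definition lip_dist (p : X) : Lip X A := Build_Lip (is_lip_dist p).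

Lemma lip_const_dist p : lip_const (lip_dist p) <= 1.
Proof. by apply: lip_const_le => // x y; exact: rnorm_dist. Qed.

End DistanceMap.

Section PointMap.
Local Open Scope classical_set_scope.
Context {R : realType} {X1 X2 : compactMetricType R} {A1 A2 : cstarAlgType R}.
Context {U : Lip X1 A1 -> Lip X2 A2} {V : Lip X2 A2 -> Lip X1 A1}.
Hypotheses (Uiso : unital_isometry U) (Viso : unital_isometry V).
Hypotheses (UK : cancel U V) (VK : cancel V U).
Hypothesis A2_factor : is_factor A2.
Implicit Types (F : Lip X1 A1) (G H : Lip X2 A2).

Lemma lip_real_continuous F (f : X1 -> R) x : lip_real F f ->
  exists2 k : R, 0 <= k & forall x', `|f x - f x'| <= k * mdist x x'.
Proof.
move=> Ff; exists (lip_const F); first exact: lip_const_ge0.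
move=> x'; apply: le_trans (lip_const_ub F x x').
by rewrite !Ff -scalerBl -rmorphB rnormr.
Qed.

(* The sublevel sets [f < e] of the nonnegative scalar maps [f] with
   [U f] vanishing at [y] form a filter base: were [f < e] empty, positivity
   of [U] would give [U f >= e]. *)
Lemma common_zero y : exists p : X1, forall F (f : X1 -> R),
  lip_real F f -> (forall x, 0 <= f x) -> U F y = 0 -> f p = 0.
Proof.
have [UL _ _] := Uiso.
pose Z : set_system X1 := [set S | exists F (f : X1 -> R) (e : R),
  [/\ lip_real F f, forall x, 0 <= f x, U F y = 0, 0 < e & [set x | f x < e] `<=` S]].
have Zfilter : ProperFilter Z.
  split; first last.
    split.
    - exists 0, (fun=> 0), 1; split=> //; first by move=> x; rewrite lipE rmorph0 scale0r.
      by rewrite linear_fun0.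
    - move=> S T [F [f [e [Ff f0 UF e0 fS]]]] [G [g [d [Gg g0 UG d0 gT]]]].
      exists (F + G), (fun x => f x + g x), (Num.min e d); split.
      + by move=> x; rewrite lipE Ff Gg -scalerDl -rmorphD.
      + by move=> x; rewrite addr_ge0.
      + by rewrite linear_funD// lipE UF UG addr0.
      + by rewrite lt_min e0 d0.
      + move=> x /=; rewrite lt_min => /andP[fe gd]; split.
          by apply: fS => /=; apply: le_lt_trans fe; rewrite lerDl.
        by apply: gT => /=; apply: le_lt_trans gd; rewrite lerDr.
    - move=> S T ST [F [f [e [Ff f0 UF e0 fS]]]].
      by exists F, f, e; split=> // x /fS/ST.
  move=> [F [f [e [Ff f0 UF e0 fS]]]].
  have fe x : e <= f x by rewrite leNgt; apply/negP => /fS.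
  have pos : lip_pos (F - lip_scalar e%:c).
    move=> x; rewrite !lipE Ff -scalerBl -rmorphB.
    by apply: cposr; rewrite subr_ge0.
  have := unital_isometry_pos Uiso Viso UK pos y.
  rewrite linear_funB// !lipE UF unital_isometry_scalar// lipE sub0r.
  move=> /(cpos_anti (cposr (ltW e0))) /(congr1 (@rnorm R A2)).
  by rewrite rnormr rnorm0 ger0_norm ?ltW// => e_eq0; rewrite e_eq0 ltxx in e0.
(* By compactness the filter clusters at some [p]. If [f p > 0], the Lipschitz bound keeps [f] above
   [f p / 2] near [p]; the radius uses [k + 1] because [k] may be 0. *)
have [|p [_ pZ]] := @metric_compact R X1 Z Zfilter.
  exact: filterT.
exists p => F f Ff f0 UF; apply/eqP; rewrite eq_le f0 andbT leNgt; apply/negP => fp.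
have [k k0 kf] := lip_real_continuous p Ff.
have Zf : Z [set x | f x < f p / 2].
  by exists F, f, (f p / 2); split=> //; rewrite divr_gt0.
have pk : 0 < f p / 2 / (k + 1) by rewrite !divr_gt0// ltr_wpDl.
have [x [/= fx]] := pZ _ _ Zf (nbhsx_ballx p _ pk).
rewrite ballEmdist /= ltr_pdivlMr ?ltr_wpDl// => px.
have := kf x; have := ler_norm (f p - f x); have := mdist_ge0 p x.
have := mulr_ge0 k0 (mdist_ge0 p x); move: px fx fp.
set d := mdist p x; nra.
Qed.

(** Once the image of the distance to [p] vanishes at [y], the bounds [- k d <= F - F(p) <= k d]
    with [d] that distance and [k = L(F)] force equality at [y]. *)
Lemma unital_isometry_point y : exists p : X1, forall F, U F y = U (lip_cst (F p)) y.
Proof.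
have [UL _ _] := Uiso.
have [p pP] := common_zero y; exists p.
have dist_real : lip_real (lip_dist p : Lip X1 A1) (mdist p) by [].
have [r rE] := unital_isometry_real Uiso Viso UK VK A2_factor y dist_real.
have dist0 : U (lip_dist p) y = 0.
  suff r0 : r = 0 by rewrite rE r0 rmorph0 scale0r.
  (* The square of the distance minus [r] is nonnegative and its image vanishes at [y], so it
     vanishes at [p], where it equals [r^2]. *)
  pose F : Lip X1 A1 := lip_dist p - lip_scalar r%:c.
  have Fr x : F x = (mdist p x - r)%:c%:A by rewrite !lipE rmorphB scalerBl.
  have Fsa : lip_sa F by move=> x; rewrite Fr starr.
  have UF : U F y = 0.
    by rewrite linear_funB// !lipE rE unital_isometry_scalar// lipE subrr.
  have FF : lip_real (lip_mul F F) (fun x => (mdist p x - r) ^+ 2).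
    by move=> x; rewrite lipE Fr -scalerAl mul1r scalerA rmorphXn.
  have := pP _ _ FF (fun x => sqr_ge0 _).
  rewrite mdistxx sub0r sqrrN (unital_isometry_sqr Uiso Viso UK VK y Fsa) UF mulr0 => /(_ erefl)/eqP.
  by rewrite sqrf_eq0 => /eqP.
have sa_point F : lip_sa F -> U F y = U (lip_cst (F p)) y.
  move=> Fsa; pose k := lip_const F.
  pose G := F - lip_cst (F p).
  have Gsa x : star (G x) = G x by rewrite !lipE starB !Fsa.
  have Gk x : rnorm (G x) <= k * mdist p x.
    by rewrite !lipE metric_sym; exact: lip_const_ub.
  have pos1 : lip_pos (k%:c *: lip_dist p + G).
    move=> x; rewrite !lipE scalerA -rmorphM.
    exact: (@cpos_add_rnorm _ _ (G x) _ (Gsa x) (Gk x)).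
  have pos2 : lip_pos (k%:c *: lip_dist p - G).
    move=> x; rewrite !lipE scalerA -rmorphM.
    exact: (@cpos_sub_rnorm _ _ (G x) _ (Gsa x) (Gk x)).
  have UG : U G y = 0.
    move: (G) pos1 pos2 => {Gsa Gk} {}G pos1 pos2.
    have := unital_isometry_pos Uiso Viso UK pos1 y.
    have := unital_isometry_pos Uiso Viso UK pos2 y.
    rewrite (linear_funB _ _ UL) (linear_funD _ _ UL) (linear_funZ _ _ UL).
    rewrite !lipE dist0 scaler0 sub0r add0r => nG pG.
    exact: cpos_anti pG nG.
  by move/eqP: UG; rewrite /G (linear_funB _ _ UL) !lipE subr_eq0 => /eqP.
move=> F; have [G [H [Gsa Hsa ->]]] := lip_sa_decomposition F.
have -> : lip_cst ((G + 'i *: H) p) = lip_cst (G p) + 'i *: lip_cst (H p) :> Lip X1 A1.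
  exact: lip_eqP.
have Usplit (G' H' : Lip X1 A1) : U (G' + 'i *: H') y = U G' y + 'i *: U H' y.
  by rewrite (linear_funD _ _ UL) (linear_funZ _ _ UL).
by rewrite !Usplit -(sa_point _ Gsa) -(sa_point _ Hsa).
Qed.

End PointMap.

Lemma unital_isometry_map (R : realType) (X1 X2 : compactMetricType R)
    (A1 A2 : cstarAlgType R) (U : Lip X1 A1 -> Lip X2 A2) (V : Lip X2 A2 -> Lip X1 A1) :
  unital_isometry U -> unital_isometry V -> cancel U V -> cancel V U ->
  is_factor A2 -> exists phi : X2 -> X1, forall F y, U F y = U (lip_cst (F (phi y))) y.
Proof.
move=> Uiso Viso UK VK A2_factor.
by have [phi Uphi] := choice (unital_isometry_point Uiso Viso UK VK A2_factor); exists phi.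
Qed.

(** * The point map preserves distances *)

Section DistanceTransport.
Context {R : realType} {X1 X2 : compactMetricType R} {A1 A2 : cstarAlgType R}.
Context {U : Lip X1 A1 -> Lip X2 A2} {V : Lip X2 A2 -> Lip X1 A1}.
Context {phi : X2 -> X1} {phi' : X1 -> X2}.
Hypotheses (Uiso : unital_isometry U) (Viso : unital_isometry V) (UK : cancel U V).
Hypothesis Uphi : forall F y, U F y = U (lip_cst (F (phi y))) y.
Hypothesis Vphi : forall G x, V G x = V (lip_cst (G (phi' x))) x.

Let U_dist p y : U (lip_dist p) y = (mdist p (phi y))%:c%:A.
Proof. by rewrite Uphi unital_isometry_scalar. Qed.

(** Evaluating [V (U (lip_dist x))] at [x] gives the distance from [x] to [phi (phi' x)] on one side
    and 0 on the other. *)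
Lemma point_map_cancel : cancel phi' phi.
Proof.
move=> x; apply/esym/mdist_positivity.
have := congr1 (fun F : Lip X1 A1 => F x) (UK (lip_dist x)).
rewrite /= Vphi U_dist unital_isometry_scalar// mdistxx lipE.
by move=> /(congr1 (@rnorm R A1)); rewrite !rnormr normr0 (ger0_norm (mdist_ge0 _ _)).
Qed.

(** The image of the distance to [phi y] is still 1-Lipschitz; compare its values at [y] and
    [y']. *)
Lemma point_map_le y y' : mdist (phi y) (phi y') <= mdist y y'.
Proof.
have dsa : lip_sa (lip_dist (phi y) : Lip X1 A1) by move=> x; rewrite starr.
have [_ UL] := unital_isometry_sa Uiso Viso UK dsa.
have := lip_const_ub (U (lip_dist (phi y))) y y'.
rewrite UL !U_dist mdistxx -scalerBl -rmorphB rnormr sub0r normrN.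
rewrite ger0_norm ?mdist_ge0// => /le_trans; apply.
rewrite -[leRHS]mul1r ler_wpM2r ?mdist_ge0//.
exact: lip_const_dist.
Qed.

End DistanceTransport.

(** * The theorem *)

Lemma unital_isometry_of (R : realType) (X1 X2 : compactMetricType R)
    (A1 A2 : cstarAlgType R) (U : Lip X1 A1 -> Lip X2 A2) :
  surjective_linear_isometry U -> U (lip_cst (1 : A1)) = lip_cst (1 : A2) ->
  unital_isometry U /\ exists V, [/\ unital_isometry V, cancel U V & cancel V U].
Proof.
move=> [UL Unorm Usurj] U1.
have Uiso : unital_isometry U.
  split=> // F; have := Unorm F 0; rewrite linear_fun0// !subr0.
  by move/complexI.
have [V VK] := choice Usurj; split=> //; exists V.
have Uinj : injective U.
  move=> F G FG; have := Unorm F G; rewrite FG subrr normr0 => /esym/normr0_eq0.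
  by move/eqP; rewrite subr_eq0 => /eqP.
have UK : cancel U V by move=> F; apply: Uinj; rewrite VK.
split=> //; split.
- by move=> c F G; apply: Uinj; rewrite VK UL !VK.
- by move=> F; have [_ norm _] := Uiso; rewrite -norm VK.
- by rewrite -U1 UK.
Qed.

Lemma lip_norm_cst (R : realType) (X : compactMetricType R) (A : cstarAlgType R) (a : A) :
  lip_norm (lip_cst a : Lip X A) = rnorm a.
Proof.
have [x0 _] := @metric_nonempty R X.
have -> : rnorm a = rnorm a + 0 by rewrite addr0.
congr (_ + _); apply/eqP; rewrite eq_le.
  by rewrite (sup_norm_ub (lip_cst a) x0) andbT; apply: sup_norm_le.
by rewrite lip_const_ge0 andbT; apply: lip_const_le => // x y; rewrite subrr rnorm0 mul0r.
Qed.

Theorem theorem1p2 (R : realType) (X1 X2 : compactMetricType R)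
    (A1 A2 : cstarAlgType R) (A1_factor : is_factor A1)
    (A2_factor : is_factor A2) (U : Lip X1 A1 -> Lip X2 A2) :
  (surjective_linear_isometry U /\ U (lip_cst (1 : A1)) = lip_cst (1 : A2)) <->
  (exists (psi : A1 -> A2) (phi : X2 -> X1),
     [/\ surjective_linear_isometry psi /\ psi 1 = 1,
         surjective_isometry phi &
         forall (F : Lip X1 A1) (y : X2), U F y = psi (F (phi y))]).
Proof.
split=> [[Usli U1]|[psi [phi [[[psiL psi_iso psi_surj] psi1] [phi_iso phi_surj] Upsi]]]].
  have [Uiso [V [Viso UK VK]]] := unital_isometry_of Usli U1.
  have [phi Uphi] := unital_isometry_map Uiso Viso UK VK A2_factor.
  have [phi' Vphi] := unital_isometry_map Viso Uiso VK UK A1_factor.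
  have phiK' := point_map_cancel Uiso Viso UK Uphi Vphi.
  have phi'K := point_map_cancel Viso Uiso VK Vphi Uphi.
  have [y0 _] := @metric_nonempty R X2; have [UL Unorm _] := Uiso.
  (* The choice of [y0] is immaterial, since images of constants are constant. *)
  pose psi (a : A1) := U (lip_cst a) y0.
  have Ucst a y : U (lip_cst a) y = psi a.
    exact: (unital_isometry_cst Uiso Viso UK).
  exists psi, phi; split.
  - split; last by rewrite /psi U1.
    have psiL : linear psi.
      move=> c a b; rewrite /psi.
      have -> : lip_cst (c *: a + b) = c *: lip_cst a + lip_cst b :> Lip X1 A1.
        exact: lip_eqP.
      by rewrite UL.
    split=> //.
      move=> a b; rewrite -(linear_funB _ _ psiL) !rnormE; congr (_%:c).
      rewrite -(lip_norm_cst X1 (a - b)) -Unorm -(lip_norm_cst X2); congr (lip_norm _).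
      by apply: lip_eqP => y; rewrite Ucst.
    move=> b; have [x0 _] := @metric_nonempty R X1; exists (V (lip_cst b) x0).
    rewrite /psi; have -> : lip_cst (V (lip_cst b) x0) = V (lip_cst b).
      by apply: lip_eqP => x; rewrite lipE; exact: (unital_isometry_cst Viso Uiso VK).
    by rewrite VK.
  - split; last by move=> x; exists (phi' x); exact: phiK'.
    (* The reverse inequality is the same lemma for the inverse point map [phi']. *)
    move=> y y'; apply/eqP; rewrite eq_le (point_map_le Uiso Viso UK Uphi)/=.
    rewrite -{1}(phi'K y) -{1}(phi'K y').
    exact: (point_map_le Viso Uiso VK Vphi).
  - by move=> F y; rewrite Uphi Ucst.
have psi_norm a : rnorm (psi a) = rnorm a.
  by apply: (@complexI R); rewrite -!rnormE -[psi a]subr0 -(linear_fun0 psiL) psi_iso subr0.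
have UL : linear U.
  by move=> c F G; apply: lip_eqP => y; rewrite !lipE !Upsi lipE psiL.
have Unorm F : lip_norm (U F) = lip_norm F.
  congr (_ + _); apply/eqP; rewrite eq_le; apply/andP; split.
  - by apply: sup_norm_le => y; rewrite Upsi psi_norm sup_norm_ub.
  - apply: sup_norm_le => x; have [y <-] := phi_surj x.
    by rewrite -psi_norm -Upsi sup_norm_ub.
  - apply: lip_const_le => [|y y']; first exact: lip_const_ge0.
    by rewrite !Upsi -(linear_funB _ _ psiL) psi_norm -phi_iso lip_const_ub.
  - apply: lip_const_le => [|x x']; first exact: lip_const_ge0.
    have [y <-] := phi_surj x; have [y' <-] := phi_surj x'.
    by rewrite -psi_norm (linear_funB _ _ psiL) -!Upsi phi_iso lip_const_ub.
split; last by apply: lip_eqP => y; rewrite Upsi.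
split=> // [F G|G].
  by rewrite -(linear_funB _ _ UL) !rnormE; congr (_%:c); exact: Unorm.
(* A preimage of [G] is [psi' \o G \o phi'], with [psi'] and [phi'] right inverses. *)
have [phi' phiK'] := choice phi_surj; have [psi' psiK'] := choice psi_surj.
have lipF : (fun x => psi' (G (phi' x))) \in is_lip.
  apply/is_lipP; exists (lip_const G); first exact: lip_const_ge0.
  move=> x x'; rewrite -psi_norm (linear_funB _ _ psiL) !psiK'.
  by rewrite -{2}(phiK' x) -{2}(phiK' x') phi_iso lip_const_ub.
exists (Build_Lip lipF); apply: lip_eqP => y; rewrite Upsi /= psiK'.
have phi_inj y' : phi y' = phi y -> y' = y.
  by move=> yy'; apply: mdist_positivity; rewrite -phi_iso yy' mdistxx.
by rewrite (phi_inj (phi' (phi y))).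
Qed.
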